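(* Let $\delta_1,\delta_2\in\mathbb{R}$. Let $(M^{2m},\varphi,g)$ be a para-Kähler–Norden manifold, let its tangent bundle $TM$ be endowed with the $\varphi$-Sasaki metric $g^{\varphi}$, and let $\xi$ be a vector field on $M$. Then $\xi:(M^{2m},\varphi,g)\to(TM,g^{\varphi})$ is an interpolating sesqui-harmonic map if and only if the following conditions hold: $$\delta_1S(\xi)+\delta_2\bar{\Delta}S(\xi)+\delta_2R(\varphi\xi,\bar{\Delta}\xi)S(\xi)-\delta_2\mathrm{Tr}_g\big(R(S(\xi),\ast)\ast+(\nabla_{S(\xi)}R)(\varphi\xi,\nabla_{\ast}\xi)\ast+R(\varphi\xi,\nabla_{\ast}\xi)\nabla_{\ast}S(\xi)-R(\varphi\xi,R(\ast,S(\xi))\xi)\ast-R(\varphi\xi,\nabla_{\ast}\bar{\Delta}\xi)\ast-R(\varphi\bar{\Delta}\xi,\nabla_{\ast}\xi)\ast\big)=0,$$ and $$\delta_1\bar{\Delta}\xi+\delta_2\bar{\Delta}^2\xi-\delta_2\mathrm{Tr}_g\big((\nabla_{\ast}R)(\ast,S(\xi))\xi+R(\ast,\nabla_{\ast}S(\xi))\xi+2R(\ast,S(\xi))\nabla_{\ast}\xi\big)=0.$$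
   Context: All manifolds, maps and tensor fields are smooth. A para-Kähler–Norden manifold $(M^{2m},\varphi,g)$ is a $2m$-dimensional manifold $M$ with a Riemannian metric $g$ and a $(1,1)$-tensor field $\varphi$ such that $\varphi^2=I$, $\varphi\neq\pm I$, the $+1$ and $-1$ eigenbundles of $\varphi$ have the same rank, $g(\varphi V,W)=g(V,\varphi W)$ for all vector fields $V,W$, and $\nabla\varphi=0$, where $\nabla$ is the Levi-Civita connection of $g$. $R(X,Y)Z=\nabla_X\nabla_YZ-\nabla_Y\nabla_XZ-\nabla_{[X,Y]}Z$ is the curvature tensor of $g$. $\mathrm{Tr}_g$ of an expression containing two asterisks means $\sum_i$ of the expression with both asterisks replaced by $e_i$, for a local $g$-orthonormal frame $\{e_i\}$. For a vector field $W$ on $M$, ${}^{H}W$ and ${}^{V}W$ are its horizontal (with respect to $\nabla$) and vertical lifts to $TM$. The $\varphi$-Sasaki metric $g^{\varphi}$ is the pseudo-Riemannian metric on $TM$ with $g^{\varphi}({}^{H}W,{}^{H}Z)=g(W,Z)$, $g^{\varphi}({}^{H}W,{}^{V}Z)=0$, $g^{\varphi}({}^{V}W,{}^{V}Z)=g(W,\varphi Z)$ (the right-hand sides being composed with the projection $TM\to M$). A vector field $\xi$ on $M$ is regarded as a map $\xi:M\to TM$. For a vector field $X$ on $M$, $\bar{\Delta}X=-\mathrm{Tr}_g(\nabla_{\ast}\nabla_{\ast}-\nabla_{\nabla_{\ast}\ast})X$ is the rough Laplacian, $\bar{\Delta}^2X=\bar{\Delta}\bar{\Delta}X$, and $S(\xi)=\mathrm{Tr}_gR(\varphi\xi,\nabla_{\ast}\xi)\ast$.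 For a smooth map $\psi:(M,g)\to(N,h)$ into a (pseudo-)Riemannian manifold, the tension field is $\tau(\psi)=\mathrm{Tr}_g\nabla d\psi$, and the bitension field is $\tau_2(\psi)=\Delta^{\psi}\tau(\psi)-\mathrm{Tr}_gR^{N}(\tau(\psi),d\psi)d\psi$, where $\Delta^{\psi}=-\mathrm{Tr}_g(\nabla^{\psi}_{\ast}\nabla^{\psi}_{\ast}-\nabla^{\psi}_{\nabla_{\ast}\ast})$ is the rough Laplacian on sections of $\psi^{-1}TN$ and $R^N$ is the curvature tensor of $N$ (same sign convention as $R$). The map $\psi$ is interpolating sesqui-harmonic (for given $\delta_1,\delta_2$) if it is a critical point of $E_{\delta_1,\delta_2}(\psi)=\delta_1\int_K|d\psi|^2v_g+\delta_2\int_K|\tau(\psi)|^2v_g$ (for every compact domain $K$, norms taken with respect to $g$ and $h$), equivalently if $\tau_{\delta_1,\delta_2}(\psi)=\delta_1\tau(\psi)+\delta_2\tau_2(\psi)=0$. *)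

(* Defs.v *)
From mathcomp Require Import all_boot all_order all_algebra.
From mathcomp Require Import all_classical all_reals all_analysis.

Set Implicit Arguments.
Unset Strict Implicit.
Unset Printing Implicit Defensive.

Import Order.TTheory GRing.Theory Num.Theory.
Import numFieldNormedType.Exports.

Local Open Scope classical_set_scope.
Local Open Scope ring_scope.

(* Vectors of R^n are row vectors; endomorphisms act on them from the right,
   and 'D_v f x is the derivative of f at x in the direction v. *)

Fixpoint Cr (R : realType) (V W : normedModType R) (k : nat) (U : set V)
    (f : V -> W) : Prop :=
  if k is k'.+1 then
    (forall x, U x -> differentiable f x) /\ (forall v, Cr k' U ('D_v f))
  else forall x, U x -> {for x, continuous f}.

(* The function [f] is total, but its values off the open set [U] are
   irrelevant. *)
Definition smooth_on (R : realType) (V W : normedModType R) (U : set V)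
    (f : V -> W) : Prop := forall k, Cr k U f.

(* [pt c] is meaningful only on the image of [crd c], where it is the inverse of
   [crd c].  Every point [p] comes with a preferred chart [chart_at p]; the
   tangent space at [p] is R^n, a tangent vector being identified with its
   components in the chart [chart_at p]. *)
Record atlas (R : realType) (n : nat) := Atlas {
  point :> Type;
  chart : Type;
  dom : chart -> set point;
  crd : chart -> point -> 'rV[R]_n;
  pt : chart -> 'rV[R]_n -> point;
  chart_at : point -> chart }.

Arguments chart {R n} _.
Arguments dom {R n a} _ _.
Arguments crd {R n a} _ _.
Arguments pt {R n a} _ _.
Arguments chart_at {R n a} _.

Definition image_chart (R : realType) (n : nat) (M : atlas R n) (c : chart M) :
  set 'rV[R]_n := crd c @` dom c.

Definition trans (R : realType) (n : nat) (M : atlas R n) (c d : chart M) :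
  'rV[R]_n -> 'rV[R]_n := fun x => crd d (pt c x).

Definition mopen (R : realType) (n : nat) (M : atlas R n) (U : set M) : Prop :=
  forall c : chart M, open (crd c @` (dom c `&` U)).

Record is_manifold (R : realType) (n : nat) (M : atlas R n) : Prop := IsManifold {
  manifold_chart_at : forall p : M, dom (chart_at p) p;
  manifold_crdK : forall (c : chart M) (p : M), dom c p -> pt c (crd c p) = p;
  manifold_open : forall c d : chart M, open (crd c @` (dom c `&` dom d));
  manifold_smooth : forall c d : chart M,
    smooth_on (crd c @` (dom c `&` dom d)) (trans c d);
  manifold_hausdorff : forall p q : M, p <> q ->
    exists U V : set M, [/\ mopen U, mopen V, U p, V q & U `&` V = set0];
  manifold_second_countable : exists B : nat -> set M,
    (forall i, mopen (B i)) /\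
    (forall U, mopen U -> forall p, U p -> exists i, B i p /\ B i `<=` U) }.

(* A point of TM is a pair [(p, v)] with [v] given in the chart [chart_at p].
   The chart of TM induced by [c] is
   [(p, v) |-> (coordinates of p, components of v in c)]. *)
Definition tangent_bundle (R : realType) (n : nat) (M : atlas R n) :
    atlas R (n + n) :=
  @Atlas R (n + n) (M * 'rV[R]_n)%type (chart M)
    (fun c => [set u | dom c u.1])
    (fun c u => row_mx (crd c u.1)
       ('D_(u.2) (trans (chart_at u.1) c) (crd (chart_at u.1) u.1)))
    (fun c y => let p := pt c (lsubmx y) in
       (p, 'D_(rsubmx y) (trans c (chart_at p)) (lsubmx y)))
    (fun u => chart_at u.1).

(* A tensor field is the family of its component functions in all the charts; the
   transformation laws are part of the predicates [is_*_field] below. *)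
Definition vector_field (R : realType) (n : nat) (M : atlas R n) : Type :=
  chart M -> 'rV[R]_n -> 'rV[R]_n.

Definition tensor2 (R : realType) (n : nat) (M : atlas R n) : Type :=
  chart M -> 'rV[R]_n -> 'M[R]_n.

Definition form (R : realType) (n : nat) (G : 'M[R]_n) (v w : 'rV[R]_n) : R :=
  (v *m G *m w^T) 0 0.

Definition is_vector_field (R : realType) (n : nat) (M : atlas R n)
    (X : vector_field M) : Prop :=
  (forall c : chart M, smooth_on (image_chart c) (X c)) /\
  (forall (c d : chart M) (p : M), dom c p -> dom d p ->
     'D_(X c (crd c p)) (trans c d) (crd c p) = X d (crd d p)).

Definition is_endo_field (R : realType) (n : nat) (M : atlas R n)
    (phi : tensor2 M) : Prop :=
  (forall c : chart M, smooth_on (image_chart c) (phi c)) /\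
  (forall (c d : chart M) (p : M) (v : 'rV[R]_n), dom c p -> dom d p ->
     let x := crd c p in
     'D_(v *m phi c x) (trans c d) x = 'D_v (trans c d) x *m phi d (crd d p)).

Definition is_form_field (R : realType) (n : nat) (M : atlas R n)
    (g : tensor2 M) : Prop :=
  (forall c : chart M, smooth_on (image_chart c) (g c)) /\
  (forall (c d : chart M) (p : M) (v w : 'rV[R]_n), dom c p -> dom d p ->
     let x := crd c p in
     form (g c x) v w =
     form (g d (crd d p)) ('D_v (trans c d) x) ('D_w (trans c d) x)).

Definition is_riemannian (R : realType) (n : nat) (M : atlas R n)
    (g : tensor2 M) : Prop :=
  is_form_field g /\
  (forall (c : chart M) (x : 'rV[R]_n), image_chart c x ->
     (g c x)^T = g c x /\ (forall v, v != 0 -> 0 < form (g c x) v v)).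

Definition section_of (R : realType) (n : nat) (M : atlas R n)
    (X : vector_field M) : M -> tangent_bundle M :=
  fun p => (p, X (chart_at p) (crd (chart_at p) p)).

(* [G] is the matrix of a metric in a chart, vector fields are functions of the
   coordinates, and functions are added pointwise. *)

Definition coord_field (R : realType) (n : nat) (i : 'I_n) :
  'rV[R]_n -> 'rV[R]_n := fun=> delta_mx 0 i.

Definition christoffel (R : realType) (n : nat) (G : 'rV[R]_n -> 'M[R]_n)
    (x : 'rV[R]_n) (i j k : 'I_n) : R :=
  let dG (a b c : 'I_n) : R :=
    'D_(delta_mx 0 a) (fun y => G y b c) x in
  2^-1 * \sum_(l < n) invmx (G x) k l * (dG i j l + dG j i l - dG l i j).

Definition Gam (R : realType) (n : nat) (G : 'rV[R]_n -> 'M[R]_n)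
    (x v w : 'rV[R]_n) : 'rV[R]_n :=
  \row_(k < n) \sum_(i < n) \sum_(j < n) christoffel G x i j k * v 0 i * w 0 j.

(* Levi-Civita connection of [G], by its Christoffel symbols. *)
Definition nabla (R : realType) (n : nat) (G : 'rV[R]_n -> 'M[R]_n)
    (X Y : 'rV[R]_n -> 'rV[R]_n) : 'rV[R]_n -> 'rV[R]_n :=
  fun x => 'D_(X x) Y x + Gam G x (X x) (Y x).

Definition lie_bracket (R : realType) (n : nat)
    (X Y : 'rV[R]_n -> 'rV[R]_n) : 'rV[R]_n -> 'rV[R]_n :=
  fun x => 'D_(X x) Y x - 'D_(Y x) X x.

Definition curv (R : realType) (n : nat) (G : 'rV[R]_n -> 'M[R]_n)
    (X Y Z : 'rV[R]_n -> 'rV[R]_n) : 'rV[R]_n -> 'rV[R]_n :=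
  nabla G X (nabla G Y Z) - nabla G Y (nabla G X Z)
  - nabla G (lie_bracket X Y) Z.

(* (nabla_W R)(X, Y) Z *)
Definition nabla_curv (R : realType) (n : nat) (G : 'rV[R]_n -> 'M[R]_n)
    (W X Y Z : 'rV[R]_n -> 'rV[R]_n) : 'rV[R]_n -> 'rV[R]_n :=
  nabla G W (curv G X Y Z) - curv G (nabla G W X) Y Z
  - curv G X (nabla G W Y) Z - curv G X Y (nabla G W Z).

(* The curvature is tensorial, so that its value on tangent vectors at [x] may be
   computed with constant extensions. *)
Definition curv_at (R : realType) (n : nat) (G : 'rV[R]_n -> 'M[R]_n)
    (x u v w : 'rV[R]_n) : 'rV[R]_n :=
  curv G (fun=> u) (fun=> v) (fun=> w) x.

Definition apply_endo (R : realType) (n : nat) (Phi : 'rV[R]_n -> 'M[R]_n)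
    (X : 'rV[R]_n -> 'rV[R]_n) : 'rV[R]_n -> 'rV[R]_n :=
  fun x => X x *m Phi x.

(* (nabla_X Phi) Y *)
Definition nabla_endo (R : realType) (n : nat) (G Phi : 'rV[R]_n -> 'M[R]_n)
    (X Y : 'rV[R]_n -> 'rV[R]_n) : 'rV[R]_n -> 'rV[R]_n :=
  nabla G X (apply_endo Phi Y) - apply_endo Phi (nabla G X Y).

(* Metric trace of an expression B( *, * ), as g^{ij} B(d_i, d_j).  See
   [trace_orthonormal] for orthonormal frames. *)
Definition trg (R : realType) (n k : nat) (G : 'rV[R]_n -> 'M[R]_n)
    (B : ('rV[R]_n -> 'rV[R]_n) -> ('rV[R]_n -> 'rV[R]_n) ->
         'rV[R]_n -> 'rV[R]_k) : 'rV[R]_n -> 'rV[R]_k :=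
  fun x => \sum_(i < n) \sum_(j < n)
    invmx (G x) i j *: B (coord_field i) (coord_field j) x.

Definition rough_lap (R : realType) (n : nat) (G : 'rV[R]_n -> 'M[R]_n)
    (X : 'rV[R]_n -> 'rV[R]_n) : 'rV[R]_n -> 'rV[R]_n :=
  - trg G (fun U V => nabla G U (nabla G V X) - nabla G (nabla G U V) X).

Definition Sfield (R : realType) (n : nat) (G Phi : 'rV[R]_n -> 'M[R]_n)
    (X : 'rV[R]_n -> 'rV[R]_n) : 'rV[R]_n -> 'rV[R]_n :=
  trg G (fun U V => curv G (apply_endo Phi X) (nabla G U X) V).

(* [f] is a map in charts, [G] and [H] are the metrics of the source and of the
   target, and sections of the pullback of the tangent bundle of the target are
   functions of the coordinates of the source. *)

Definition dmap (R : realType) (n k : nat) (f : 'rV[R]_n -> 'rV[R]_k)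
    (X : 'rV[R]_n -> 'rV[R]_n) : 'rV[R]_n -> 'rV[R]_k :=
  fun x => 'D_(X x) f x.

Definition pullback_nabla (R : realType) (n k : nat) (H : 'rV[R]_k -> 'M[R]_k)
    (f : 'rV[R]_n -> 'rV[R]_k) (X : 'rV[R]_n -> 'rV[R]_n)
    (V : 'rV[R]_n -> 'rV[R]_k) : 'rV[R]_n -> 'rV[R]_k :=
  fun x => 'D_(X x) V x + Gam H (f x) (dmap f X x) (V x).

Definition tension (R : realType) (n k : nat) (G : 'rV[R]_n -> 'M[R]_n)
    (H : 'rV[R]_k -> 'M[R]_k) (f : 'rV[R]_n -> 'rV[R]_k) :
    'rV[R]_n -> 'rV[R]_k :=
  trg G (fun U V => pullback_nabla H f U (dmap f V) - dmap f (nabla G U V)).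

Definition pullback_lap (R : realType) (n k : nat) (G : 'rV[R]_n -> 'M[R]_n)
    (H : 'rV[R]_k -> 'M[R]_k) (f : 'rV[R]_n -> 'rV[R]_k)
    (W : 'rV[R]_n -> 'rV[R]_k) : 'rV[R]_n -> 'rV[R]_k :=
  - trg G (fun U V => pullback_nabla H f U (pullback_nabla H f V W)
                      - pullback_nabla H f (nabla G U V) W).

Definition bitension (R : realType) (n k : nat) (G : 'rV[R]_n -> 'M[R]_n)
    (H : 'rV[R]_k -> 'M[R]_k) (f : 'rV[R]_n -> 'rV[R]_k) :
    'rV[R]_n -> 'rV[R]_k :=
  pullback_lap G H f (tension G H f)
  - trg G (fun U V x =>
      curv_at H (f x) (tension G H f x) (dmap f U x) (dmap f V x)).

Definition map_in_charts (R : realType) (n k : nat) (M : atlas R n)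
    (N : atlas R k) (psi : M -> N) (c : chart M) (d : chart N) :
    'rV[R]_n -> 'rV[R]_k := fun x => crd d (psi (pt c x)).

(* The equation [sesqui_tension = 0] is the Euler-Lagrange equation of
   delta1 int |d psi|^2 + delta2 int |tau(psi)|^2.  [sesqui_tension] is the vector
   delta1 tau(psi) + delta2 tau2(psi) at [p], an element of the
   tangent space of [N] at [psi p], i.e. given in the chart [chart_at (psi p)]. *)
Definition sesqui_tension (R : realType) (n k : nat) (M : atlas R n)
    (N : atlas R k) (g : tensor2 M) (h : tensor2 N) (delta1 delta2 : R)
    (psi : M -> N) (p : M) : 'rV[R]_k :=
  let c := chart_at p in
  let d := chart_at (psi p) in
  let f := map_in_charts psi c d in
  (delta1 *: tension (g c) (h d) f + delta2 *: bitension (g c) (h d) f) (crd c p).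

Definition sesqui_harmonic (R : realType) (n k : nat) (M : atlas R n)
    (N : atlas R k) (g : tensor2 M) (h : tensor2 N) (delta1 delta2 : R)
    (psi : M -> N) : Prop :=
  forall p : M, sesqui_tension g h delta1 delta2 psi p = 0.

Record para_kahler_norden (R : realType) (m : nat) (M : atlas R (2 * m))
    (phi g : tensor2 M) : Prop := ParaKahlerNorden {
  pkn_manifold : is_manifold M;
  pkn_riemannian : is_riemannian g;
  pkn_endo : is_endo_field phi;
  pkn_involution : forall (c : chart M) x, image_chart c x ->
    phi c x *m phi c x = 1%:M;
  pkn_neq1 : ~ (forall (c : chart M) x, image_chart c x -> phi c x = 1%:M);
  pkn_neqN1 : ~ (forall (c : chart M) x, image_chart c x -> phi c x = - 1%:M);
  pkn_rank : forall (c : chart M) x, image_chart c x ->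
    \rank (eigenspace (phi c x) 1) = \rank (eigenspace (phi c x) (- 1));
  pkn_pure : forall (c : chart M) x, image_chart c x -> forall v w,
    form (g c x) (v *m phi c x) w = form (g c x) v (w *m phi c x);
  pkn_parallel : forall (c : chart M) (X Y : 'rV[R]_(2 * m) -> 'rV[R]_(2 * m)),
    smooth_on (image_chart c) X -> smooth_on (image_chart c) Y ->
    forall x, image_chart c x -> nabla_endo (g c) (phi c) X Y x = 0 }.

(* Tangent vectors of TM at the point with coordinates [y = (x, u)] are rows
   [(a, b)], where [a] is the projection to the base. *)

Definition hlift (R : realType) (n : nat) (G : 'rV[R]_n -> 'M[R]_n)
    (y : 'rV[R]_(n + n)) (w : 'rV[R]_n) : 'rV[R]_(n + n) :=
  row_mx w (- Gam G (lsubmx y) w (rsubmx y)).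

Definition vlift (R : realType) (n : nat) (w : 'rV[R]_n) : 'rV[R]_(n + n) :=
  row_mx 0 w.

(* The vertical part of [a]: [a] is the sum of the horizontal lift of [lsubmx a]
   and of the vertical lift of [connector G y a]. *)
Definition connector (R : realType) (n : nat) (G : 'rV[R]_n -> 'M[R]_n)
    (y a : 'rV[R]_(n + n)) : 'rV[R]_n :=
  rsubmx a + Gam G (lsubmx y) (lsubmx a) (rsubmx y).

Definition phi_sasaki_form (R : realType) (n : nat) (G Phi : 'rV[R]_n -> 'M[R]_n)
    (y a b : 'rV[R]_(n + n)) : R :=
  form (G (lsubmx y)) (lsubmx a) (lsubmx b)
  + form (G (lsubmx y)) (connector G y a) (connector G y b *m Phi (lsubmx y)).

(* Characterised by [phi_sasaki_hh], [phi_sasaki_hv] and [phi_sasaki_vv]. *)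
Definition phi_sasaki (R : realType) (n : nat) (M : atlas R n) (phi g : tensor2 M) :
    tensor2 (tangent_bundle M) :=
  fun (c : chart M) (y : 'rV[R]_(n + n)) =>
    \matrix_(i, j) phi_sasaki_form (g c) (phi c) y (delta_mx 0 i) (delta_mx 0 j).

Lemma Gam_linear (R : realType) (n : nat) (G : 'rV[R]_n -> 'M[R]_n)
    (x w : 'rV[R]_n) : linear (fun v => Gam G x v w).
Proof.
move=> a u v; apply/rowP => k; rewrite !mxE mulr_sumr -big_split /=.
apply: eq_bigr => i _; rewrite mulr_sumr -big_split /=.
by apply: eq_bigr => j _; rewrite !mxE mulrDr mulrDl mulrCA !mulrA.
Qed.

Lemma formDZl (R : realType) (n : nat) (G : 'M[R]_n) (a : R) (u v w : 'rV[R]_n) :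
  form G (a *: u + v) w = a * form G u w + form G v w.
Proof. by rewrite /form !mulmxDl -!scalemxAl !mxE. Qed.

Lemma formDZr (R : realType) (n : nat) (G : 'M[R]_n) (a : R) (u v w : 'rV[R]_n) :
  form G w (a *: u + v) = a * form G w u + form G w v.
Proof. by rewrite /form linearP mulmxDr -scalemxAr !mxE. Qed.

Lemma connector_linear (R : realType) (n : nat) (G : 'rV[R]_n -> 'M[R]_n)
    (y : 'rV[R]_(n + n)) : linear (connector G y).
Proof.
move=> a u v; rewrite /connector !linearP Gam_linear scalerDr.
by rewrite addrACA.
Qed.

Lemma phi_sasaki_formDZl (R : realType) (n : nat) (G Phi : 'rV[R]_n -> 'M[R]_n)
    (y : 'rV[R]_(n + n)) (a : R) (u v w : 'rV[R]_(n + n)) :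
  phi_sasaki_form G Phi y (a *: u + v) w =
  a * phi_sasaki_form G Phi y u w + phi_sasaki_form G Phi y v w.
Proof.
by rewrite /phi_sasaki_form connector_linear linearP !formDZl mulrDr addrACA.
Qed.

Lemma phi_sasaki_formDZr (R : realType) (n : nat) (G Phi : 'rV[R]_n -> 'M[R]_n)
    (y : 'rV[R]_(n + n)) (a : R) (u v w : 'rV[R]_(n + n)) :
  phi_sasaki_form G Phi y w (a *: u + v) =
  a * phi_sasaki_form G Phi y w u + phi_sasaki_form G Phi y w v.
Proof.
rewrite /phi_sasaki_form connector_linear mulmxDl -scalemxAl linearP !formDZr.
by rewrite mulrDr addrACA.
Qed.

Lemma bilinear_formE (R : realType) (n : nat) (B : 'rV[R]_n -> 'rV[R]_n -> R) :
  (forall a u v w, B (a *: u + v) w = a * B u w + B v w) ->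
  (forall a u v w, B w (a *: u + v) = a * B w u + B w v) ->
  forall u v, form (\matrix_(i, j) B (delta_mx 0 i) (delta_mx 0 j)) u v = B u v.
Proof.
move=> Bl Br u v.
have B0l w : B 0 w = 0.
  by have /esym/eqP := Bl 1 0 0 w; rewrite scaler0 addr0 mul1r -subr_eq0 addrK => /eqP.
have B0r w : B w 0 = 0.
  by have /esym/eqP := Br 1 0 0 w; rewrite scaler0 addr0 mul1r -subr_eq0 addrK => /eqP.
have suml (F : 'I_n -> 'rV[R]_n) (a : 'I_n -> R) w :
    B (\sum_i a i *: F i) w = \sum_i a i * B (F i) w.
  by elim/big_rec2: _ => [|i y1 y2 _ <-] //; rewrite ?B0l // Bl.
have sumr (F : 'I_n -> 'rV[R]_n) (a : 'I_n -> R) w :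
    B w (\sum_i a i *: F i) = \sum_i a i * B w (F i).
  by elim/big_rec2: _ => [|i y1 y2 _ <-] //; rewrite ?B0r // Br.
rewrite {2}[u]row_sum_delta suml {2}[v]row_sum_delta.
rewrite /form mxE.
under eq_bigr => j _ do rewrite mxE mulr_suml.
rewrite exchange_big /=; apply: eq_bigr => i _.
rewrite sumr mulr_sumr; apply: eq_bigr => j _.
by rewrite !mxE; rewrite -!mulrA; congr (_ * _); rewrite mulrC.
Qed.

Lemma phi_sasakiE (R : realType) (n : nat) (M : atlas R n) (phi g : tensor2 M)
    (c : chart M) (y a b : 'rV[R]_(n + n)) :
  form (phi_sasaki phi g c y) a b = phi_sasaki_form (g c) (phi c) y a b.
Proof.
rewrite /phi_sasaki; apply: bilinear_formE => *.
- exact: phi_sasaki_formDZl.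
- exact: phi_sasaki_formDZr.
Qed.

Lemma connector_hlift (R : realType) (n : nat) (G : 'rV[R]_n -> 'M[R]_n) y w :
  connector G y (hlift G y w) = 0.
Proof. by rewrite /connector /hlift row_mxKl row_mxKr addNr. Qed.

Lemma connector_vlift (R : realType) (n : nat) (G : 'rV[R]_n -> 'M[R]_n) y w :
  connector G y (vlift w) = w.
Proof.
rewrite /connector /vlift row_mxKl row_mxKr.
suff -> : Gam G (lsubmx y) 0 (rsubmx y) = 0 by rewrite addr0.
by apply/rowP => k; rewrite !mxE; apply: big1 => i _; apply: big1 => j _;
  rewrite mxE mulr0 mul0r.
Qed.

Lemma phi_sasaki_hh (R : realType) (n : nat) (M : atlas R n) (phi g : tensor2 M)
    (c : chart M) y v w :
  form (phi_sasaki phi g c y) (hlift (g c) y v) (hlift (g c) y w) =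
  form (g c (lsubmx y)) v w.
Proof.
rewrite phi_sasakiE /phi_sasaki_form !connector_hlift /hlift !row_mxKl.
by rewrite [X in _ + X]/form !mul0mx mxE addr0.
Qed.

Lemma phi_sasaki_hv (R : realType) (n : nat) (M : atlas R n) (phi g : tensor2 M)
    (c : chart M) y v w :
  form (phi_sasaki phi g c y) (hlift (g c) y v) (vlift w) = 0.
Proof.
rewrite phi_sasakiE /phi_sasaki_form connector_hlift /hlift /vlift !row_mxKl.
by rewrite /form trmx0 mulmx0 !mul0mx mxE addr0.
Qed.

Lemma phi_sasaki_vv (R : realType) (n : nat) (M : atlas R n) (phi g : tensor2 M)
    (c : chart M) y v w :
  form (phi_sasaki phi g c y) (vlift v) (vlift w) =
  form (g c (lsubmx y)) v (w *m phi c (lsubmx y)).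
Proof.
rewrite phi_sasakiE /phi_sasaki_form !connector_vlift /vlift !row_mxKl.
by rewrite [X in X + _]/form !mul0mx mxE add0r.
Qed.

(* The rows of [E] form a [G]-orthonormal basis. *)
Lemma trace_orthonormal (R : realType) (n k : nat) (G E : 'M[R]_n)
    (B : 'rV[R]_n -> 'rV[R]_n -> 'rV[R]_k) :
  (forall a u v w, B (a *: u + v) w = a *: B u w + B v w) ->
  (forall a u v w, B w (a *: u + v) = a *: B w u + B w v) ->
  E *m G *m E^T = 1%:M ->
  \sum_(i < n) \sum_(j < n) invmx G i j *: B (delta_mx 0 i) (delta_mx 0 j) =
  \sum_(l < n) B (row l E) (row l E).
Proof.
move=> Bl Br EGE.
have B0l w : B 0 w = 0.
  by have /esym/eqP := Bl 1 0 0 w; rewrite scaler0 addr0 scale1r -subr_eq0 addrK => /eqP.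
have B0r w : B w 0 = 0.
  by have /esym/eqP := Br 1 0 0 w; rewrite scaler0 addr0 scale1r -subr_eq0 addrK => /eqP.
have suml (F : 'I_n -> 'rV[R]_n) (a : 'I_n -> R) w :
    B (\sum_i a i *: F i) w = \sum_i a i *: B (F i) w.
  by elim/big_rec2: _ => [|i y1 y2 _ <-] //; rewrite ?B0l // Bl.
have sumr (F : 'I_n -> 'rV[R]_n) (a : 'I_n -> R) w :
    B w (\sum_i a i *: F i) = \sum_i a i *: B w (F i).
  by elim/big_rec2: _ => [|i y1 y2 _ <-] //; rewrite ?B0r // Br.
have ETEG : E^T *m E *m G = 1%:M by rewrite -mulmxA (mulmx1C EGE).
have Gu : G \in unitmx by case: (mulmx1_unit ETEG).
have -> : invmx G = E^T *m E by rewrite -[LHS]mul1mx -ETEG mulmxK.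
have BE u v : B u v =
    \sum_i \sum_j (u 0 i * v 0 j) *: B (delta_mx 0 i) (delta_mx 0 j).
  rewrite [in LHS](row_sum_delta u) suml; apply: eq_bigr => i _.
  rewrite [in LHS](row_sum_delta v) sumr scaler_sumr; apply: eq_bigr => j _.
  by rewrite scalerA.
under [RHS]eq_bigr => l _ do rewrite BE.
rewrite [RHS]exchange_big /=; apply: eq_bigr => i _.
rewrite [RHS]exchange_big /=; apply: eq_bigr => j _.
rewrite !mxE scaler_suml; apply: eq_bigr => l _.
by rewrite !mxE.
Qed.

(* Main.v *)
Require Import Defs.
From HB Require Import structures.
From mathcomp Require Import all_boot all_order all_algebra.
From mathcomp Require Import all_classical all_reals all_analysis.
From mathcomp Require Import ring lra.

Set Implicit Arguments.
Unset Strict Implicit.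
Unset Printing Implicit Defensive.

Import Order.TTheory GRing.Theory Num.Theory.
Import numFieldNormedType.Exports.
Import Defs.

Local Open Scope classical_set_scope.
Local Open Scope ring_scope.

(* Everything happens in one chart.  In a chart of TM the section xi is
   x |-> (x, X x), and a tangent vector of TM is a pair (A, B) of base vectors
   through its horizontal and vertical parts.  Koszul's formula, purity and the
   pair symmetry of the curvature give the Levi-Civita connection of the
   phi-Sasaki metric along a map z |-> (b z, s z):
     (A, B) |-> (D A + 1/2 R(phi s, D s) A + 1/2 R(phi s, B) db,
                 D B - 1/2 R(db, A) s).
   For the section it gives the tension field (S, - Lap xi); iterating it gives
   the rough Laplacian of the tension field, and commuting it along the identity
   of TM gives the curvature of TM.  In the trace over the base the horizontal and
   vertical parts of the bitension field collapse to the two stated expressions: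
   the other terms cancel by symmetrization of the trace and by the antisymmetry
   of R and of its covariant derivative in their first two tensor arguments. *)

(** * Calculus of smooth maps *)

(** Keeping the base map [b] general makes one connection formula serve twice: along the section,
    and along the identity of TM, where it is the connection of TM itself. The curvature of TM is
    then a commutator of the same second derivatives whose trace is the Laplacian, so the
    Christoffel symbols of TM are never differentiated. Linearity of [b] keeps its second
    derivatives out of these formulas.

    Koszul's formula produces pairings of R(.,.)u with phi w, which have to be represented by
    horizontal vectors. A parallel phi commutes with R, and purity then lets pair symmetry move the
    free argument into the metric; this is where R(phi u, w) comes from. Since phi is parallel, no
    derivative ever falls on it.

    The integrands of the bitension field do not agree index by index with those of the theorem:
    they agree only after adding the transposed index pair. The term R(phi xi, Lap xi) S(xi) outside
    the trace is what symmetrization leaves over.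

    Fields are total functions that are meaningful only on the chart image, so derivatives are
    compared through equality on an open set, and every use of tensoriality asks for smoothness of
    each argument. *)

Section Smooth.
Context {R : realType}.
Implicit Types V W : normedModType R.

Lemma near_open V (U : set V) (P : V -> Prop) x :
  open U -> U x -> (forall y, U y -> P y) -> \near x, P x.
Proof. by move=> oU Ux UP; apply: filterS UP _; exact: open_nbhs_nbhs. Qed.

Lemma eq_on_derive V W (U : set V) (f g : V -> W) x v :
  open U -> (forall y, U y -> f y = g y) -> U x -> 'D_v f x = 'D_v g x.
Proof. by move=> oU fg Ux; apply: near_eq_derive; exact: near_open fg. Qed.

(** The difference [g - f] vanishes near [x], so the zero map [Z] satisfies the defining expansion
    of its differential; adding the difference to [f] gives [g]. *)
Lemma near_eq_differentiable V W (f g : V -> W) x :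
  (\near x, f x = g x) -> differentiable f x -> differentiable g x.
Proof.
move=> fg df.
suff de : differentiable (g - f) x.
  have -> : g = f + (g - f) by rewrite addrC subrK.
  exact: differentiableD.
pose Z : {linear V -> W} := \0.
have exp0 : (g - f) \o shift x = cst ((g - f) x) + Z +o_ 0 id.
  apply/eqaddoP => e e0; near=> h.
  have -> : ((g - f) \o shift x - (cst ((g - f) x) + Z)) h =
            (g - f) (h + x) - (g - f) x - 0 by rewrite /= !fctE opprD addrA.
  have fgx : (g - f) x = 0 by rewrite !fctE (nbhs_singleton fg) subrr.
  rewrite fgx !subr0.
  have -> : (g - f) (h + x) = 0.
    rewrite !fctE; apply/eqP; rewrite subr_eq0 eq_sym; apply/eqP.
    near: h; move: fg; rewrite (near_shift 0) subr0 /=; apply: filterS => h /=.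
    by [].
  by rewrite normr0 mulr_ge0 // ltW.
have c0 : continuous Z by exact: cst_continuous.
apply/diff_locallyP; rewrite (diff_unique c0 exp0); split => //.
Unshelve. all: by end_near. Qed.

Lemma Cr_eq V W (U : set V) k (f g : V -> W) :
  open U -> (forall y, U y -> f y = g y) -> Cr k U f -> Cr k U g.
Proof.
move=> oU; elim: k f g => [|k IH] f g fg /=.
  move=> fc x Ux; apply: cvg_trans; last by rewrite -(fg x Ux); exact: fc.
  by apply: near_eq_cvg; exact: near_open fg.
move=> [df Df]; split=> [x Ux|v].
  by apply: near_eq_differentiable (df x Ux); exact: near_open fg.
by apply: IH (Df v) => y Uy; exact: eq_on_derive fg Uy.
Qed.

(** Introduction rule for [Cr]: the definition speaks of the total function ['D_v f], whereas a
    formula for the derivative is available only on [U]. *)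
Lemma Cr_derive V W (U : set V) k (f : V -> W) (df : V -> V -> W) :
  open U -> (forall x, U x -> differentiable f x) ->
  (forall v x, U x -> 'D_v f x = df v x) -> (forall v, Cr k U (df v)) ->
  Cr k.+1 U f.
Proof.
move=> oU dif fE cdf; split=> // v.
by apply: Cr_eq (cdf v) => // y Uy; rewrite fE.
Qed.

Lemma CrW V W (U : set V) k (f : V -> W) : Cr k.+1 U f -> Cr k U f.
Proof.
elim: k f => [|k IH] f [df Df].
  by move=> x Ux; apply: differentiable_continuous; exact: df.
by split=> // v; apply: IH.
Qed.

Lemma Cr_differentiable V W (U : set V) k (f : V -> W) x :
  Cr k.+1 U f -> U x -> differentiable f x.
Proof. by case=> df _; exact: df. Qed.

Lemma Cr_D V W (U : set V) k (f : V -> W) v : Cr k.+1 U f -> Cr k U ('D_v f).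
Proof. by case=> _; exact. Qed.

Lemma Cr_cst V W (U : set V) k (a : W) : Cr k U (fun=> a).
Proof.
elim: k a => [|k IH] a; first by move=> x _; exact: cst_continuous.
split=> [x _|v]; first exact: differentiable_cst.
have -> : 'D_v (fun=> a) = fun=> (0 : W) by apply/funext => x; exact: derive_cst.
exact: IH.
Qed.

Lemma CrD V W (U : set V) k (f g : V -> W) : open U ->
  Cr k U f -> Cr k U g -> Cr k U (fun x => f x + g x).
Proof.
move=> oU; elim: k f g => [|k IH] f g.
  by move=> cf cg x Ux; apply: continuousD; [exact: cf|exact: cg].
move=> cf cg; have df := Cr_differentiable cf; have dg := Cr_differentiable cg.
apply: (Cr_derive (df := fun v x => 'D_v f x + 'D_v g x)) => //.
- by move=> x Ux; apply: differentiableD; [exact: df|exact: dg].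
- by move=> v x Ux; rewrite deriveD //; apply: diff_derivable; [exact: df|exact: dg].
- by move=> v; apply: IH => //; exact: Cr_D.
Qed.

Lemma derive_comp_linear V V' W (L : {linear V' -> V}) (f : V -> W) x v :
  continuous L -> differentiable f (L x) ->
  'D_v (fun y => f (L y)) x = 'D_(L v) f (L x).
Proof.
move=> cL df.
have dL : differentiable L x by exact: linear_differentiable.
rewrite deriveE; last exact: differentiable_comp.
by rewrite diff_comp //= diff_lin // -deriveE.
Qed.

(** The direction [L v] does not depend on the point, so the derivative is again a function composed
    with [L] and the induction on the order closes. *)
Lemma Cr_comp_linear V V' W (U : set V) k (L : {linear V' -> V}) (f : V -> W) :
  open U -> continuous L -> Cr k U f -> Cr k (L @^-1` U) (fun x => f (L x)).
Proof.
move=> oU cL.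
have oU' : open (L @^-1` U) by apply: open_comp => // x _; exact: cL.
elim: k f => [|k IH] f.
  by move=> cf x Ux; apply: continuous_comp; [exact: cL|exact: cf].
move=> cf; have df := Cr_differentiable cf; apply: (Cr_derive (df := fun v x => 'D_(L v) f (L x))) => //.
- move=> x Ux; apply: differentiable_comp; last exact: df.
  exact: linear_differentiable.
- by move=> v x Ux; apply: derive_comp_linear => //; exact: df.
- by move=> v; apply: (IH ('D_(L v) f)); exact: Cr_D.
Qed.

Let scale_bilinear (W : normedModType R) :
  bilinear_for (GRing.Scale.Law.clone _ _ *:%R _) (GRing.Scale.Law.clone _ _ *:%R _)
    (@GRing.scale R W : R -> W -> W).
Proof.
split=> [u'|u] a x y /=; first by rewrite scalerDl scalerA.
by rewrite scalerDr !scalerA mulrC.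
Qed.

(** Scaling is a continuous bilinear map; the Leibniz rule is the general formula for the
    differential of such a map. *)
Let is_diff_scale (W : normedModType R) (p : R * W) :
  is_diff p (fun q : R * W => q.1 *: q.2) (fun q : R * W => p.1 *: q.2 + q.1 *: p.2).
Proof.
pose B : {bilinear R -> W -> W} := HB.pack (@GRing.scale R W : R -> W -> W)
  (bilinear_isBilinear.Build R R W W _ _ (@GRing.scale R W : R -> W -> W) (scale_bilinear W)).
have cB : continuous (fun p : R * W => B p.1 p.2) by move=> q; exact: scale_continuous.
apply: DiffDef; first exact: (differentiable_bilin (f := B)).
by rewrite (diff_bilin (f := B)).
Qed.

Lemma differentiable_scale V W (f : V -> R) (g : V -> W) x :
  differentiable f x -> differentiable g x ->
  differentiable (fun y => f y *: g y) x.
Proof.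
move=> df dg.
apply: (differentiable_comp (f := fun y => (f y, g y)) (g := fun q : R * W => q.1 *: q.2)).
  exact: differentiable_pair.
by have [] := is_diff_scale (f x, g x).
Qed.

Lemma derive_scale V W (f : V -> R) (g : V -> W) x v :
  differentiable f x -> differentiable g x ->
  'D_v (fun y => f y *: g y) x = f x *: 'D_v g x + 'D_v f x *: g x.
Proof.
move=> df dg; rewrite deriveE; last exact: differentiable_scale.
have dp := differentiable_pair df dg.
have [ds Ds] := is_diff_scale (f x, g x).
rewrite [X in 'd X x](_ : _ = (fun q : R * W => q.1 *: q.2) \o (fun y => (f y, g y))) //.
by rewrite diff_comp // Ds diff_pair //= -!deriveE.
Qed.

Lemma Cr_scale V W (U : set V) k (f : V -> R) (g : V -> W) : open U ->
  Cr k U f -> Cr k U g -> Cr k U (fun x => f x *: g x).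
Proof.
move=> oU; elim: k f g => [|k IH] f g.
  by move=> cf cg x Ux; apply: continuousZ; [exact: cf|exact: cg].
move=> cf cg; have df := Cr_differentiable cf; have dg := Cr_differentiable cg.
apply: (Cr_derive (df := fun v x => f x *: 'D_v g x + 'D_v f x *: g x)) => //.
- by move=> x Ux; apply: differentiable_scale; [exact: df|exact: dg].
- by move=> v x Ux; rewrite derive_scale //; [exact: df|exact: dg].
- by move=> v; apply: CrD => //; apply: IH => //; (exact: CrW || exact: Cr_D).
Qed.

(** The derivative of 1/f is a product of two factors 1/f and a derivative of f, so order [k] of 1/f
    yields order [k.+1]. *)
Lemma Cr_inv V (U : set V) k (f : V -> R) : open U ->
  (forall x, U x -> f x != 0) -> Cr k U f -> Cr k U (fun x => (f x)^-1).
Proof.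
move=> oU f0; elim: k => [|k IH].
  by move=> cf x Ux; apply: continuousV; [exact: f0|exact: cf].
move=> cf; have df := Cr_differentiable cf.
apply: (Cr_derive (df := fun v x => (- ((f x)^-1 * (f x)^-1)) * 'D_v f x)) => //.
- by move=> x Ux; apply: differentiableV; [exact: df|exact: f0].
- move=> v x Ux; rewrite deriveV; [|exact: f0|by apply: diff_derivable; exact: df].
  by rewrite /GRing.scale /= -exprVn expr2.
- move=> v; have ck := IH (CrW cf); apply: (Cr_scale (W := R)) => //.
  have -> : (fun x => - ((f x)^-1 * (f x)^-1)) = (fun x => -1 *: ((f x)^-1 *: (f x)^-1 : R)).
    by apply/funext => x; rewrite /GRing.scale /= mulN1r.
  apply: (Cr_scale (W := R)) => //; first exact: Cr_cst.
    exact: (Cr_scale (W := R)).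
  exact: Cr_D.
Qed.

Lemma linear_row_sum n W (T : 'rV[R]_n -> W) w : linear T ->
  T w = \sum_(i <- index_enum 'I_n) w 0 i *: T (delta_mx 0 i).
Proof.
move=> linT; pose L : {linear 'rV[R]_n -> W} :=
  HB.pack T (GRing.isLinear.Build _ _ _ _ _ linT).
rewrite -[T]/(L : 'rV[R]_n -> W) [in LHS](row_sum_delta w) linear_sum.
by apply: eq_bigr => i _; rewrite linearZ.
Qed.

Lemma derive_linear_dir V W (f : V -> W) x :
  differentiable f x -> linear (fun v => 'D_v f x).
Proof. by move=> df a u v; rewrite !deriveE // linearP. Qed.

Section SmoothOn.
Variables (V : normedModType R) (U : set V).
Hypothesis oU : open U.

Lemma smooth_differentiable W (f : V -> W) x :
  smooth_on U f -> U x -> differentiable f x.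
Proof. by move=> /(_ 1) sf; exact: Cr_differentiable sf. Qed.

Lemma smooth_derivable W (f : V -> W) x v :
  smooth_on U f -> U x -> derivable f x v.
Proof. by move=> sf Ux; apply/diff_derivable/smooth_differentiable. Qed.

Lemma smooth_D W (f : V -> W) v : smooth_on U f -> smooth_on U ('D_v f).
Proof. by move=> sf k; apply: Cr_D. Qed.

Lemma smooth_eq W (f g : V -> W) :
  (forall y, U y -> f y = g y) -> smooth_on U f -> smooth_on U g.
Proof. by move=> fg sf k; apply: Cr_eq (sf k). Qed.

Lemma smooth_cst W (a : W) : smooth_on U (fun=> a).
Proof. by move=> k; exact: Cr_cst. Qed.

Lemma smoothD W (f g : V -> W) :
  smooth_on U f -> smooth_on U g -> smooth_on U (fun x => f x + g x).
Proof. by move=> sf sg k; apply: CrD. Qed.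

Lemma smooth_scale W (f : V -> R) (g : V -> W) :
  smooth_on U f -> smooth_on U g -> smooth_on U (fun x => f x *: g x).
Proof. by move=> sf sg k; apply: Cr_scale. Qed.

Lemma smoothM (f g : V -> R) :
  smooth_on U f -> smooth_on U g -> smooth_on U (fun x => f x * g x).
Proof. exact: (smooth_scale (W := R)). Qed.

Lemma smoothZ W (a : R) (f : V -> W) :
  smooth_on U f -> smooth_on U (fun x => a *: f x).
Proof. by apply: smooth_scale; exact: smooth_cst. Qed.

Lemma smoothN W (f : V -> W) : smooth_on U f -> smooth_on U (fun x => - f x).
Proof.
by move=> /(@smoothZ _ (-1)); apply: smooth_eq => x _; rewrite scaleN1r.
Qed.

Lemma smoothB W (f g : V -> W) :
  smooth_on U f -> smooth_on U g -> smooth_on U (fun x => f x - g x).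
Proof. by move=> sf sg; apply: smoothD => //; exact: smoothN. Qed.

Lemma smooth_inv (f : V -> R) : (forall x, U x -> f x != 0) ->
  smooth_on U f -> smooth_on U (fun x => (f x)^-1).
Proof. by move=> f0 sf k; apply: Cr_inv. Qed.

Lemma smooth_sum W I (r : seq I) (f : I -> V -> W) :
  (forall i, smooth_on U (f i)) -> smooth_on U (fun x => \sum_(i <- r) f i x).
Proof.
move=> sf; elim: r => [|i r IH].
  by apply: smooth_eq (smooth_cst (0 : W)) => x _; rewrite big_nil.
by apply: smooth_eq (smoothD (sf i) IH) => x _; rewrite big_cons.
Qed.

Lemma smooth_prod I (r : seq I) (f : I -> V -> R) :
  (forall i, smooth_on U (f i)) -> smooth_on U (fun x => \prod_(i <- r) f i x).
Proof.
move=> sf; elim: r => [|i r IH].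
  by apply: smooth_eq (smooth_cst (1 : R)) => x _; rewrite big_nil.
by apply: smooth_eq (smoothM (sf i) IH) => x _; rewrite big_cons.
Qed.

Lemma derive_sum_seq W I (r : seq I) (f : I -> V -> W) x v : U x ->
  (forall i, smooth_on U (f i)) ->
  'D_v (fun x => \sum_(i <- r) f i x) x = \sum_(i <- r) 'D_v (f i) x.
Proof.
move=> Ux sf; elim: r => [|i r IH].
  rewrite big_nil -[RHS](@derive_cst R V W 0 x v); apply: eq_on_derive Ux => // y _.
  by rewrite big_nil.
rewrite big_cons -IH.
rewrite -(@deriveD _ _ _ (f i) (fun x => \sum_(i <- r) f i x)).
- by apply: eq_on_derive Ux => // y _; rewrite big_cons.
- exact: smooth_derivable.
- by apply: smooth_derivable => //; exact: smooth_sum.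
Qed.

Lemma derive_entry p q (A : V -> 'M[R]_(p, q)) i j x v :
  derivable A x v -> 'D_v (fun y => A y i j) x = ('D_v A x) i j.
Proof. by move=> dA; rewrite derive_mx // mxE. Qed.

Lemma smooth_entry p q (A : V -> 'M[R]_(p, q)) i j :
  smooth_on U A -> smooth_on U (fun y => A y i j).
Proof.
move=> sA k; elim: k A sA => [|k IH] A sA.
  move=> x Ux; apply: (@continuous_comp _ _ _ A (fun M : 'M[R]_(p, q) => M i j)).
    exact: sA 0 x Ux.
  exact: coord_continuous.
apply: (Cr_derive (df := fun v x => ('D_v A x) i j)) => //.
- move=> x Ux; apply: (@differentiable_comp _ _ _ _ A (fun M : 'M[R]_(p, q) => M i j)).
    exact: smooth_differentiable.
  exact: differentiable_coord.
- by move=> v x Ux; apply: derive_entry; exact: smooth_derivable.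
- by move=> v; apply: IH; exact: smooth_D.
Qed.

Lemma smooth_mx p q (A : V -> 'M[R]_(p, q)) :
  (forall i j, smooth_on U (fun y => A y i j)) -> smooth_on U A.
Proof.
move=> sA; have s := smooth_sum (index_enum 'I_p) (fun i =>
  smooth_sum (index_enum 'I_q) (fun j =>
  smooth_scale (sA i j) (smooth_cst (delta_mx i j : 'M[R]_(p, q))))).
by apply: smooth_eq s => x _; rewrite [RHS]matrix_sum_delta.
Qed.

Lemma smooth_det n (A : V -> 'M[R]_n) :
  smooth_on U A -> smooth_on U (fun x => \det (A x)).
Proof.
move=> sA; rewrite /determinant; apply: smooth_sum => s.
apply: smoothM; first exact: smooth_cst.
by apply: smooth_prod => i; exact: smooth_entry.
Qed.

(** By Cramer's rule: the adjugate and the determinant are polynomials in the entries. *)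
Lemma smooth_invmx n (A : V -> 'M[R]_n) :
  (forall x, U x -> A x \in unitmx) -> smooth_on U A ->
  smooth_on U (fun x => invmx (A x)).
Proof.
move=> uA sA.
apply: (@smooth_eq _ (fun x => (\det (A x))^-1 *: \adj (A x))).
  by move=> x Ux; rewrite /invmx uA.
apply: smooth_scale.
  apply: smooth_inv; last exact: smooth_det.
  by move=> x Ux; move: (uA x Ux); rewrite unitmxE unitfE.
apply: smooth_mx => i j.
apply: (@smooth_eq _ (fun x => cofactor (A x) j i)); first by move=> x _; rewrite mxE.
apply: smoothM; first exact: smooth_cst.
apply: smooth_det; apply: smooth_mx => k l.
apply: smooth_eq (smooth_entry (lift j k) (lift i l) sA) => x _.
by rewrite !mxE.
Qed.

Section Apply.
Variables (n : nat) (W : normedModType R) (T : V -> 'rV[R]_n -> W) (A : V -> 'rV[R]_n).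
Hypothesis linT : forall x, U x -> linear (T x).
Hypothesis sT : forall v, smooth_on U (T ^~ v).
Hypothesis sA : smooth_on U A.

Let TE x w : U x -> T x w = \sum_(i <- index_enum 'I_n) w 0 i *: T x (delta_mx 0 i).
Proof. by move=> Ux; apply: linear_row_sum; exact: linT. Qed.

Lemma smooth_apply : smooth_on U (fun x => T x (A x)).
Proof.
apply: (@smooth_eq _ (fun x => \sum_(i <- index_enum 'I_n) A x 0 i *: T x (delta_mx 0 i))).
  by move=> x Ux; rewrite -TE.
by apply: smooth_sum => i; apply: smooth_scale => //; exact: smooth_entry.
Qed.

(** Expanding [A] in the standard basis reduces this Leibniz rule to the one for scaling; in the
    first term the argument of [T] is frozen at its value at [x]. *)
Lemma derive_apply x v : U x ->
  'D_v (fun y => T y (A y)) x = 'D_v (T ^~ (A x)) x + T x ('D_v A x).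
Proof.
move=> Ux; have sAi i : smooth_on U (fun x => A x 0 i) by exact: smooth_entry.
rewrite (@eq_on_derive _ _ U _ (fun x => \sum_(i <- index_enum 'I_n) A x 0 i *: T x (delta_mx 0 i))) //;
  last by move=> y Uy; rewrite TE.
rewrite derive_sum_seq //; last by move=> i; apply: smooth_scale.
rewrite (@eq_on_derive _ _ U (T^~ (A x))
    (fun y => \sum_(i <- index_enum 'I_n) A x 0 i *: T y (delta_mx 0 i))) //;
  last by move=> y Uy; rewrite TE.
rewrite derive_sum_seq //; last by move=> i; apply: smoothZ.
rewrite [T x ('D_v A x)]TE // -big_split; apply: eq_bigr => i _ /=.
rewrite derive_scale; [|exact: smooth_differentiable (sAi i) Ux|exact: smooth_differentiable Ux].
congr (_ + _).
  by rewrite -(@deriveZ _ _ _ (T^~ (delta_mx 0 i))) //; exact: smooth_derivable.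
by rewrite derive_entry //; exact: smooth_derivable.
Qed.

End Apply.

Lemma smooth_apply_linear n W (L : 'rV[R]_n -> W) (A : V -> 'rV[R]_n) :
  linear L -> smooth_on U A -> smooth_on U (fun x => L (A x)).
Proof.
move=> linL sA; apply: (smooth_apply (T := fun=> L)) => // v; exact: smooth_cst.
Qed.

Lemma derive_apply_linear n W (L : 'rV[R]_n -> W) (A : V -> 'rV[R]_n) x v :
  linear L -> smooth_on U A -> U x ->
  'D_v (fun y => L (A y)) x = L ('D_v A x).
Proof.
move=> linL sA Ux; rewrite (derive_apply (T := fun=> L)) //; last by move=> w; exact: smooth_cst.
by rewrite derive_cst add0r.
Qed.

End SmoothOn.

Lemma smooth_comp_linear V V' W (U : set V) (L : {linear V' -> V}) (f : V -> W) :
  open U -> continuous L -> smooth_on U f ->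
  smooth_on (L @^-1` U) (fun x => f (L x)).
Proof. by move=> oU cL sf k; exact: Cr_comp_linear. Qed.

Lemma smooth_id n (U : set 'rV[R]_n) : open U -> smooth_on U id.
Proof.
move=> oU [|k]; first by move=> x _; exact: cvg_id.
apply: (Cr_derive (df := fun v => fun=> v)) => //.
- by move=> v x _; exact: derive_id.
- by move=> v; exact: Cr_cst.
Qed.

End Smooth.

(** * Symmetry of second derivatives *)

Section Schwarz.
Context {R : realType}.
Variable V : normedModType R.

Lemma is_derive_line (W : normedModType R) (f : V -> W) (y v : V) (t : R) :
  differentiable f (y + t *: v) ->
  is_derive t 1 (fun s : R => f (y + s *: v)) ('D_v f (y + t *: v)).
Proof.
move=> df; have E : (fun h : R => h^-1 *: ((f \o shift (y + t *: v)) (h *: v) - f (y + t *: v))) =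
  (fun h : R => h^-1 *: (((fun s : R => f (y + s *: v)) \o shift t) (h *: 1) - f (y + t *: v))).
  apply/funext => h /=; congr (_ *: (f _ - _)).
  by rewrite [h *: 1]mulr1 scalerDl addrCA.
split; first by rewrite /derivable -E; exact: diff_derivable df.
by rewrite /derive -E.
Qed.

Local Opaque derive.

Lemma MVT_line (f : V -> R) (y v : V) (h : R) : 0 <= h ->
  (forall t, 0 <= t <= h -> differentiable f (y + t *: v)) ->
  exists2 c, 0 <= c <= h & f (y + h *: v) - f y = 'D_v f (y + c *: v) * h.
Proof.
move=> h0 df.
have [||c] := @MVT_segment R (fun s => f (y + s *: v)) (fun s => 'D_v f (y + s *: v)) 0 h h0.
- move=> t; rewrite in_itv /= => /andP[t0 th]; apply: is_derive_line.
  by apply: df; rewrite !ltW.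
- apply: derivable_within_continuous => t; rewrite in_itv /= => t0h.
  by have [] := is_derive_line (df t t0h).
by rewrite in_itv /= subr0 scale0r addr0 => c0h E; exists c.
Qed.

(* Two applications of the mean value theorem; the left-hand side is symmetric
   in [u] and [v]. *)
Let second_difference (f : V -> R) (U : set V) (x u v : V) (h : R) :
  smooth_on U f -> 0 < h ->
  (forall s t : R, 0 <= s <= h -> 0 <= t <= h -> U (x + s *: u + t *: v)) ->
  exists s t : R, [/\ 0 <= s <= h, 0 <= t <= h &
  f (x + h *: u + h *: v) - f (x + h *: u) - f (x + h *: v) + f x =
  'D_v ('D_u f) (x + s *: u + t *: v) * h * h].
Proof.
move=> sf h0 box; have hh : 0 <= h <= h by rewrite lexx ltW.
have h00 : 0 <= (0 : R) <= h by rewrite lexx ltW.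
have dsh (w : V) t : (forall s, 0 <= s <= h -> U (w + s *: u)) -> 0 <= t <= h ->
    differentiable f (w + t *: u).
  by move=> Uw th; apply: smooth_differentiable sf _; exact: Uw.
have box1 s : 0 <= s <= h -> U ((x + h *: v) + s *: u).
  by move=> sh; rewrite addrAC; exact: box.
have box0 s : 0 <= s <= h -> U (x + s *: u).
  by move=> sh; have := box s 0 sh h00; rewrite scale0r addr0.
(* The first application is along [u], to the increment of [f] over [h *: v]; the second is along
   [v], to ['D_u f]. *)
have [||c] := @MVT_segment R
    (fun s => f (x + h *: v + s *: u) - f (x + s *: u))
    (fun s => 'D_u f (x + h *: v + s *: u) - 'D_u f (x + s *: u)) 0 h (ltW h0).
- move=> t; rewrite in_itv /= => /andP[t0 th].
  have t0h : 0 <= t <= h by rewrite !ltW.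
  by apply: is_deriveB; apply: is_derive_line; exact: dsh.
- apply: derivable_within_continuous => t; rewrite in_itv /= => t0h.
  by apply: derivableB; apply: ex_derive; apply: is_derive_line; exact: dsh.
rewrite in_itv /= !scale0r !addr0 subr0 => ch E.
have [t th|d dh E'] := @MVT_line ('D_u f) (x + c *: u) v h (ltW h0).
  by apply: smooth_differentiable (smooth_D u sf) _; exact: box.
exists c, d; split => //; rewrite -E' addrAC [x + c *: u + _]addrAC -E addrAC.
by rewrite [x + h *: v + h *: u]addrAC; ring.
Qed.

Lemma derive_swap1 (U : set V) (f : V -> R) (x u v : V) :
  open U -> smooth_on U f -> U x -> 'D_v ('D_u f) x = 'D_u ('D_v f) x.
Proof.
move=> oU sf Ux; apply/eqP; rewrite -subr_eq0 -normr_le0; apply/ler_addgt0Pr => e e0.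
rewrite add0r.
have cuv a b : {for x, continuous ('D_a ('D_b f))}.
  exact: (smooth_D a (smooth_D b sf)) 0 x Ux.
have key (a b c : R) : `|a - c| < e / 2 -> `|c - b| < e / 2 -> `|a - b| <= e.
  move=> ac cb; rewrite -(subrK c a) -addrA (le_trans (ler_normD _ _)) //.
  by rewrite [leRHS]splitr; apply: lerD; exact: ltW.
have e2 : 0 < e / 2 by rewrite divr_gt0.
pose N1 := [set y | `|'D_v ('D_u f) x - 'D_v ('D_u f) y| < e / 2].
pose N2 := [set y | `|'D_u ('D_v f) x - 'D_u ('D_v f) y| < e / 2].
have nU : nbhs x U by exact: open_nbhs_nbhs.
have n1 : nbhs x N1 by have /cvgrPdist_lt /(_ _ e2) := cuv v u.
have n2 : nbhs x N2 by have /cvgrPdist_lt /(_ _ e2) := cuv u v.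
have /nbhs_ballP[r /= r0 rN] : nbhs x (U `&` (N1 `&` N2)) by apply: filterI => //; exact: filterI.
(* The parallelogram with sides [h *: u] and [h *: v] has to lie in the ball of radius [r]; the
   [+ 1] keeps the divisor positive when both directions are zero. *)
pose h := r / (2 * (`|u| + `|v| + 1)).
have d0 : 0 < `|u| + `|v| + 1 by rewrite ltr_wpDl // addr_ge0.
have h0 : 0 < h by rewrite divr_gt0 // mulr_gt0.
have hr : h * (`|u| + `|v|) < r.
  rewrite /h mulrAC ltr_pdivrMr ?mulr_gt0 // ltr_pM2l //.
  have := normr_ge0 u; have := normr_ge0 v; lra.
clearbody h.
have box s t : 0 <= s <= h -> 0 <= t <= h -> ball x r (x + s *: u + t *: v).
  move=> /andP[s0 sh] /andP[t0 th]; rewrite -ball_normE /= -addrA opprD addrA subrr add0r normrN.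
  apply: le_lt_trans (ler_normD _ _) _; rewrite !normrZ !ger0_norm //.
  apply: le_lt_trans hr; rewrite mulrDr; apply: lerD; exact: ler_wpM2r.
have [|s [t [sh th E1]]] := @second_difference f U x u v h sf h0.
  by move=> s t sh th; case: (rN _ (box s t sh th)).
have [|s' [t' [sh' th' E2]]] := @second_difference f U x v u h sf h0.
  by move=> a b ah bh; rewrite addrAC; case: (rN _ (box b a bh ah)).
have [_ [B1 _]] := rN _ (box s t sh th).
have [_ [_ B2]] := rN _ (box t' s' th' sh').
rewrite /N2 /= addrAC in B2.
have h2 : h * h != 0 by rewrite mulf_neq0 // gt_eqF.
(* Times [h * h], both mixed derivatives equal the same second difference, each at its own
   intermediate point; continuity at [x] then compares their values there. *)
have EQ : 'D_v ('D_u f) (x + s *: u + t *: v) = 'D_u ('D_v f) (x + s' *: v + t' *: u).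
  have : 'D_v ('D_u f) (x + s *: u + t *: v) * h * h =
         'D_u ('D_v f) (x + s' *: v + t' *: u) * h * h.
    by apply: etrans (esym E1) (etrans _ E2); rewrite [x + h *: v + h *: u]addrAC; ring.
  move: ('D_v ('D_u f) _) ('D_u ('D_v f) _) => a b.
  by rewrite -!mulrA => /(mulIf h2).
rewrite -EQ distrC in B2.
exact: key B1 B2.
Qed.

Lemma derive_swap p q (U : set V) (f : V -> 'M[R]_(p, q)) (x u v : V) :
  open U -> smooth_on U f -> U x -> 'D_v ('D_u f) x = 'D_u ('D_v f) x.
Proof.
move=> oU sf Ux; apply/matrixP => i j.
have E a b : ('D_a ('D_b f) x) i j = 'D_a ('D_b (fun y => f y i j)) x.
  rewrite -derive_entry; last by apply: smooth_derivable (smooth_D b sf) Ux.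
  apply: eq_on_derive (Ux) => // y Uy.
  by rewrite derive_entry //; exact: smooth_derivable sf Uy.
exact: etrans (E v u) (etrans (derive_swap1 u v oU (smooth_entry oU i j sf) Ux) (esym (E u v))).
Qed.

End Schwarz.

Local Opaque derive.

(** * Levi-Civita connection and curvature in coordinates *)

Section Christoffel.
Context {R : realType}.

Lemma form_sumE n (A : 'M[R]_n) b c : form A b c = \sum_i \sum_j b 0 i * c 0 j * A i j.
Proof.
rewrite /form mxE exchange_big /=; apply: eq_bigr => j _.
by rewrite mxE big_distrl /=; apply: eq_bigr => i _; rewrite !mxE mulrAC.
Qed.

Lemma form_linearl n (A : 'M[R]_n) c : linear (fun b => form A b c : R).
Proof. by move=> a u v; rewrite formDZl. Qed.

Lemma form_linearr n (A : 'M[R]_n) b : linear (fun c => form A b c : R).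
Proof. by move=> a u v; rewrite formDZr. Qed.

Lemma form_sym n (A : 'M[R]_n) b c : A^T = A -> form A b c = form A c b.
Proof.
move=> As; rewrite !form_sumE exchange_big /=; apply: eq_bigr => i _; apply: eq_bigr => j _.
by rewrite -[in RHS]As mxE [c 0 i * _]mulrC.
Qed.

Lemma form_inj n (A : 'M[R]_n) u v : A \in unitmx ->
  (forall c, form A u c = form A v c) -> u = v.
Proof.
move=> uA H; apply: (can_inj (mulmxK uA)); apply/rowP => j.
have := H (delta_mx 0 j); rewrite /form.
have E (w : 'rV[R]_n) : (w *m (delta_mx 0 j : 'rV[R]_n)^T) 0 0 = w 0 j.
  rewrite mxE (bigD1 j) //= !mxE !eqxx mulr1 big1 ?addr0 // => k kj.
  by rewrite !mxE (negbTE kj) mulr0.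
by rewrite !E.
Qed.

Variables (n : nat) (U : set 'rV[R]_n) (G : 'rV[R]_n -> 'M[R]_n).
Hypothesis oU : open U.
Hypothesis sG : smooth_on U G.
Hypothesis uG : forall x, U x -> G x \in unitmx.
Hypothesis symG : forall x, U x -> (G x)^T = G x.

Lemma Gam_linearr x w : linear (fun v => Gam G x v w).
Proof. exact: Gam_linear. Qed.

Lemma Gam_linearl x v : linear (Gam G x v).
Proof.
move=> a u w; apply/rowP => k; rewrite !mxE mulr_sumr -big_split /=.
apply: eq_bigr => i _; rewrite mulr_sumr -big_split /=.
by apply: eq_bigr => j _; rewrite !mxE mulrDr mulrCA.
Qed.

Lemma smooth_Gam v w : smooth_on U (fun x => Gam G x v w).
Proof.
apply: smooth_mx => // i0 k.
apply: (@smooth_eq _ _ U _ _ (fun x => \sum_i \sum_j christoffel G x i j k * v 0 i * w 0 j)) => //.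
  by move=> x _; rewrite mxE.
apply: smooth_sum => // i; apply: smooth_sum => // j.
apply: smoothM => //; last exact: smooth_cst.
apply: smoothM => //; last exact: smooth_cst.
rewrite /christoffel; apply: smoothM => //; first exact: smooth_cst.
apply: smooth_sum => // l; apply: smoothM => //.
  by apply: smooth_entry => //; exact: smooth_invmx.
have sd a b c : smooth_on U ('D_(delta_mx 0 a) (fun y => G y b c)).
  by apply: smooth_D; exact: smooth_entry.
by apply: smoothB => //; apply: smoothD.
Qed.

Lemma smooth_form_cst v w : smooth_on U (fun x => form (G x) v w).
Proof.
apply: (@smooth_eq _ _ U _ _ (fun x => \sum_i \sum_j v 0 i * w 0 j * G x i j)) => //.
  by move=> x _; rewrite form_sumE.
apply: smooth_sum => // i; apply: smooth_sum => // j.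
by apply: smoothM => //; [exact: smooth_cst|exact: smooth_entry].
Qed.

Lemma derive_form_cst a v w x : U x ->
  'D_a (fun y => form (G y) v w) x =
  \sum_i \sum_j v 0 i * w 0 j * \sum_l a 0 l * 'D_(delta_mx 0 l) (fun y => G y i j) x.
Proof.
move=> Ux; rewrite (@eq_on_derive _ _ _ U _ (fun x => \sum_i \sum_j v 0 i * w 0 j * G x i j)) //;
  last by move=> y _; rewrite form_sumE.
have sg i j : smooth_on U (fun x => v 0 i * w 0 j * G x i j).
  by apply: smoothM => //; [exact: smooth_cst|exact: smooth_entry].
rewrite (derive_sum_seq oU) //; last by move=> i; apply: smooth_sum.
apply: eq_bigr => i _; rewrite (derive_sum_seq oU) //; apply: eq_bigr => j _.
have dg : differentiable (fun y => G y i j) x.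
  exact: smooth_differentiable (smooth_entry oU i j sG) Ux.
rewrite (@deriveZ _ _ _ (fun y => G y i j) (v 0 i * w 0 j)); last exact: diff_derivable.
congr (_ * _); exact: (linear_row_sum a (derive_linear_dir dg)).
Qed.

(** For constant fields the brackets in Koszul's formula vanish. Of the metric only smoothness,
    symmetry and invertibility are assumed, so that the formula also applies to the indefinite
    metric [sasaki]; with [form_inj] it determines [Gam]. *)
Lemma koszul v w c x : U x ->
  form (G x) (Gam G x v w) c =
  2^-1 * ('D_v (fun y => form (G y) w c) x + 'D_w (fun y => form (G y) v c) x
          - 'D_c (fun y => form (G y) v w) x).
Proof.
move=> Ux.
pose dG a b c := 'D_(delta_mx 0 a) (fun y => G y b c) x.
(* Twice the covector of the Christoffel terms with lowered index: pairing with [G x] cancels the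
   inverse matrix. *)
pose t : 'rV[R]_n := \row_l \sum_i \sum_j (dG i j l + dG j i l - dG l i j) * v 0 i * w 0 j.
have -> : Gam G x v w = 2^-1 *: (t *m invmx (G x)).
  apply/rowP => k; rewrite !mxE.
  under eq_bigr => i _ do under eq_bigr => j _ do
    rewrite /christoffel -mulrA -mulrA mulr_suml.
  under eq_bigr => i _ do rewrite -mulr_sumr exchange_big.
  rewrite -mulr_sumr exchange_big /=; congr (_ * _).
  apply: eq_bigr => l _; rewrite !mxE mulr_suml; apply: eq_bigr => i _.
  rewrite mulr_suml; apply: eq_bigr => j _.
  have -> : invmx (G x) k l = invmx (G x) l k.
    by rewrite -[in LHS](symG Ux) -trmx_inv mxE.
  by rewrite /dG; ring.
rewrite /form -scalemxAl -scalemxAl mulmxKV ?uG // [LHS]mxE; congr (_ * _).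
rewrite !derive_form_cst // [LHS]mxE.
transitivity (\sum_i \sum_j \sum_l (dG i j l + dG j i l - dG l i j) * v 0 i * w 0 j * c 0 l).
  under eq_bigr => l _ do (rewrite !mxE mulr_suml; under eq_bigr => i _ do rewrite mulr_suml).
  by rewrite exchange_big; apply: eq_bigr => i _; rewrite exchange_big.
have split3 (F1 F2 F3 : 'I_n -> 'I_n -> 'I_n -> R) :
    \sum_i \sum_j \sum_l (F1 i j l + F2 i j l - F3 i j l) =
    \sum_i \sum_j \sum_l F1 i j l + \sum_i \sum_j \sum_l F2 i j l - \sum_i \sum_j \sum_l F3 i j l.
  rewrite -sumrN -!big_split; apply: eq_bigr => i _.
  rewrite -sumrN -!big_split; apply: eq_bigr => j _.
  by rewrite -sumrN -!big_split.
under eq_bigr => i _ do under eq_bigr => j _ do under eq_bigr => l _ do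
  rewrite !mulrDl !mulNr.
rewrite split3; congr (_ + _ - _).
- rewrite exchange_big; apply: eq_bigr => j _; rewrite exchange_big; apply: eq_bigr => l _.
  by rewrite mulr_sumr; apply: eq_bigr => i _; rewrite /dG; ring.
- apply: eq_bigr => i _; rewrite exchange_big; apply: eq_bigr => l _.
  by rewrite mulr_sumr; apply: eq_bigr => j _; rewrite /dG; ring.
- apply: eq_bigr => i _; apply: eq_bigr => j _.
  by rewrite mulr_sumr; apply: eq_bigr => l _; rewrite /dG; ring.
Qed.

Lemma GamC x v w : U x -> Gam G x v w = Gam G x w v.
Proof.
move=> Ux; apply: (form_inj (uG Ux)) => c; rewrite !koszul //; congr (_ * (_ - _)).
  by rewrite addrC.
by apply: (eq_on_derive _ oU _ Ux) => y Uy; rewrite form_sym // symG.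
Qed.

(** Metric compatibility: in the sum of the two Koszul formulas the derivatives in the directions
    [v] and [w] cancel. *)
Lemma derive_form a v w x : U x ->
  'D_a (fun y => form (G y) v w) x =
  form (G x) (Gam G x a v) w + form (G x) v (Gam G x a w).
Proof.
move=> Ux; rewrite [form _ v _]form_sym ?symG // !koszul //.
have -> : 'D_a (fun y => form (G y) w v) x = 'D_a (fun y => form (G y) v w) x.
  by apply: (eq_on_derive _ oU _ Ux) => y Uy; rewrite form_sym // symG.
set X := 'D_a _ x; set Y := 'D_v _ x; set Z := 'D_w _ x; lra.
Qed.

End Christoffel.

(** * Leibniz rules for tensors along a linear base map *)

Section Tensor.
Context {R : realType}.
Variables (n k : nat) (U : set 'rV[R]_n) (W : normedModType R).
Variable b : 'rV[R]_k -> 'rV[R]_n.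
Hypothesis oU : open U.
Hypothesis lb : linear b.
Hypothesis cb : continuous b.
Let Ub := b @^-1` U.

Lemma open_preimage : open Ub.
Proof. by apply: open_comp => // x _; exact: cb. Qed.

Let oUb := open_preimage.

Lemma smooth_base (f : 'rV[R]_n -> W) : smooth_on U f -> smooth_on Ub (fun z => f (b z)).
Proof.
pose L : {linear 'rV[R]_k -> 'rV[R]_n} := HB.pack b (GRing.isLinear.Build _ _ _ _ _ lb).
exact: (smooth_comp_linear (L := L)).
Qed.

Lemma derive_base (f : 'rV[R]_n -> W) a z : smooth_on U f -> Ub z ->
  'D_a (fun z => f (b z)) z = 'D_(b a) f (b z).
Proof.
pose L : {linear 'rV[R]_k -> 'rV[R]_n} := HB.pack b (GRing.isLinear.Build _ _ _ _ _ lb).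
move=> sf Uz; apply: (derive_comp_linear (L := L)) => //.
exact: smooth_differentiable sf Uz.
Qed.

Section Order1.
Variable T : 'rV[R]_n -> 'rV[R]_n -> W.
Hypothesis linT : forall x, U x -> linear (T x).
Hypothesis sT : forall v, smooth_on U (T^~ v).

Lemma smooth_tensor1 A : smooth_on Ub A -> smooth_on Ub (fun z => T (b z) (A z)).
Proof.
move=> sA; apply: (smooth_apply oUb (T := fun z => T (b z))) => // [z Uz|v].
  exact: linT.
exact: smooth_base (sT v).
Qed.

Lemma derive_tensor1 A a z : smooth_on Ub A -> Ub z ->
  'D_a (fun z => T (b z) (A z)) z =
  'D_(b a) (T^~ (A z)) (b z) + T (b z) ('D_a A z).
Proof.
move=> sA Uz; rewrite (derive_apply oUb (T := fun z => T (b z))) //.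
- by congr (_ + _); exact: derive_base (sT _) Uz.
- by move=> x Ux; exact: linT.
- by move=> v; exact: smooth_base (sT v).
Qed.
End Order1.

Section Order2.
Variable T : 'rV[R]_n -> 'rV[R]_n -> 'rV[R]_n -> W.
Hypothesis linT1 : forall x w, U x -> linear (fun v => T x v w).
Hypothesis linT2 : forall x v, U x -> linear (T x v).
Hypothesis sT : forall v w, smooth_on U (fun x => T x v w).

Lemma smooth_tensor2 A B : smooth_on Ub A -> smooth_on Ub B ->
  smooth_on Ub (fun z => T (b z) (A z) (B z)).
Proof.
move=> sA sB; apply: (smooth_apply oUb (T := fun z => T (b z) (A z))) => // [z Uz|v].
  exact: linT2.
by apply: (smooth_tensor1 (T := fun x w => T x w v)) => // x Ux; exact: linT1.
Qed.

(** [derive_apply] peels off the last slot, and the rule of the previous order, with that slot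
    frozen, treats the others. Order three repeats this. *)
Lemma derive_tensor2 A B a z : smooth_on Ub A -> smooth_on Ub B -> Ub z ->
  'D_a (fun z => T (b z) (A z) (B z)) z =
  'D_(b a) (fun x => T x (A z) (B z)) (b z) + T (b z) ('D_a A z) (B z)
  + T (b z) (A z) ('D_a B z).
Proof.
move=> sA sB Uz; rewrite (derive_apply oUb (T := fun z => T (b z) (A z))) //.
- congr (_ + _); apply: (derive_tensor1 (T := fun x w => T x w (B z))) => // x Ux.
  exact: linT1.
- by move=> x Ux; exact: linT2.
- move=> v; apply: (smooth_tensor1 (T := fun x w => T x w v)) => // x Ux.
  exact: linT1.
Qed.
End Order2.

Section Order3.
Variable T : 'rV[R]_n -> 'rV[R]_n -> 'rV[R]_n -> 'rV[R]_n -> W.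
Hypothesis linT1 : forall x v w, U x -> linear (fun u => T x u v w).
Hypothesis linT2 : forall x u w, U x -> linear (fun v => T x u v w).
Hypothesis linT3 : forall x u v, U x -> linear (T x u v).
Hypothesis sT : forall u v w, smooth_on U (fun x => T x u v w).

Lemma smooth_tensor3 A B C : smooth_on Ub A -> smooth_on Ub B -> smooth_on Ub C ->
  smooth_on Ub (fun z => T (b z) (A z) (B z) (C z)).
Proof.
move=> sA sB sC; apply: (smooth_apply oUb (T := fun z => T (b z) (A z) (B z))) => // [z Uz|v].
  exact: linT3.
by apply: (smooth_tensor2 (T := fun x u w => T x u w v)) => // x w Ux; [exact: linT1|exact: linT2].
Qed.

Lemma derive_tensor3 A B C a z :
  smooth_on Ub A -> smooth_on Ub B -> smooth_on Ub C -> Ub z ->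
  'D_a (fun z => T (b z) (A z) (B z) (C z)) z =
  'D_(b a) (fun x => T x (A z) (B z) (C z)) (b z) + T (b z) ('D_a A z) (B z) (C z)
  + T (b z) (A z) ('D_a B z) (C z) + T (b z) (A z) (B z) ('D_a C z).
Proof.
move=> sA sB sC Uz; rewrite (derive_apply oUb (T := fun z => T (b z) (A z) (B z))) //.
- congr (_ + _); apply: (derive_tensor2 (T := fun x u v => T x u v (C z))) => // x w Ux.
    exact: linT1.
  exact: linT2.
- by move=> x Ux; exact: linT3.
- move=> v; apply: (smooth_tensor2 (T := fun x u w => T x u w v)) => // x w Ux.
    exact: linT1.
  exact: linT2.
Qed.
End Order3.

End Tensor.

(** Stated for the predicate [linear]: maps such as a slot of the curvature are proved linear only
    at points of [U] and carry no linear structure. *)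
Lemma linear_0 (R : pzRingType) (V W : lmodType R) (f : V -> W) : linear f -> f 0 = 0.
Proof. by move=> /(_ (-1) 0 0); rewrite scaler0 addr0 scaleN1r addNr. Qed.

Lemma linear_add (R : pzRingType) (V W : lmodType R) (f : V -> W) u v :
  linear f -> f (u + v) = f u + f v.
Proof. by move=> /(_ 1 u v); rewrite !scale1r. Qed.

Lemma linear_scale (R : pzRingType) (V W : lmodType R) (f : V -> W) a u :
  linear f -> f (a *: u) = a *: f u.
Proof. by move=> lf; have := lf a u 0; rewrite !addr0 (linear_0 lf) addr0. Qed.

Lemma linear_opp (R : pzRingType) (V W : lmodType R) (f : V -> W) u :
  linear f -> f (- u) = - f u.
Proof. by move=> lf; rewrite -scaleN1r (linear_scale _ _ lf) scaleN1r. Qed.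

Lemma linear_sub (R : pzRingType) (V W : lmodType R) (f : V -> W) u v :
  linear f -> f (u - v) = f u - f v.
Proof. by move=> lf; rewrite (linear_add _ _ lf) (linear_opp _ lf). Qed.

(** * Multilinearity, antisymmetry and the first Bianchi identity of the curvature *)

Section Curvature.
Context {R : realType}.
Variables (n : nat) (U : set 'rV[R]_n) (G : 'rV[R]_n -> 'M[R]_n).
Hypothesis oU : open U.
Hypothesis sG : smooth_on U G.
Hypothesis uG : forall x, U x -> G x \in unitmx.
Hypothesis symG : forall x, U x -> (G x)^T = G x.

Local Notation Gm := (Gam G).
Local Notation K := (curv_at G).

Lemma Gam0l x w : Gm x 0 w = 0.
Proof. exact: linear_0 (Gam_linearr G x w). Qed.

Let sGam := smooth_Gam oU sG uG.

Lemma curv_atE x u v w : K x u v w =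
  'D_u (fun y => Gm y v w) x + Gm x u (Gm x v w)
  - ('D_v (fun y => Gm y u w) x + Gm x v (Gm x u w)).
Proof.
rewrite /curv_at /curv.
have nab a c : nabla G (fun=> a) (fun=> c) = fun x => Gm x a c.
  by apply/funext => y; rewrite /nabla derive_cst add0r.
rewrite !nab.
have -> : lie_bracket (fun=> u) (fun=> v) = fun=> 0.
  by apply/funext => y; rewrite /lie_bracket !derive_cst subrr.
by rewrite nab !fctE /nabla Gam0l subr0.
Qed.

Let GamDZl x a u v w : Gm x (a *: u + v) w = a *: Gm x u w + Gm x v w.
Proof. exact: Gam_linearr. Qed.
Let GamDZr x a u v w : Gm x w (a *: u + v) = a *: Gm x w u + Gm x w v.
Proof. exact: Gam_linearl. Qed.

Let dG v w x : U x -> differentiable (fun y => Gm y v w) x.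
Proof. by move=> Ux; exact: smooth_differentiable (sGam v w) Ux. Qed.

Let deriveDZ (h f g : 'rV[R]_n -> 'rV[R]_n) a v x :
  (forall y, h y = a *: f y + g y) -> U x -> smooth_on U f -> smooth_on U g ->
  'D_v h x = a *: 'D_v f x + 'D_v g x.
Proof.
move=> hE Ux sf sg; have -> : h = (fun y => a *: f y) + g by apply/funext => y; rewrite hE.
rewrite deriveD.
- by rewrite (@deriveZ _ _ _ f) //; exact: smooth_derivable sf Ux.
- exact: smooth_derivable (smoothZ oU a sf) Ux.
- exact: smooth_derivable sg Ux.
Qed.

Let dGDZl a p u v w x : U x -> 'D_p (fun y => Gm y (a *: u + v) w) x =
  a *: 'D_p (fun y => Gm y u w) x + 'D_p (fun y => Gm y v w) x.
Proof. by move=> Ux; apply: deriveDZ => // y; exact: GamDZl. Qed.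

Let dGDZr a p u v w x : U x -> 'D_p (fun y => Gm y w (a *: u + v)) x =
  a *: 'D_p (fun y => Gm y w u) x + 'D_p (fun y => Gm y w v) x.
Proof. by move=> Ux; apply: deriveDZ => // y; exact: GamDZr. Qed.

Let rearr (a : R) (x1 x2 x3 x4 y1 y2 y3 y4 : 'rV[R]_n) :
  a *: x1 + y1 + (a *: x2 + y2) - (a *: x3 + y3 + (a *: x4 + y4)) =
  a *: (x1 + x2 - (x3 + x4)) + (y1 + y2 - (y3 + y4)).
Proof. by apply/rowP => i; rewrite !mxE; ring. Qed.

Lemma curv_linear1 x v w : U x -> linear (fun u => K x u v w).
Proof.
move=> Ux a u u'; rewrite !curv_atE.
by rewrite (derive_linear_dir (dG v w Ux)) dGDZl // !GamDZl GamDZr rearr.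
Qed.

Lemma curv_linear2 x u w : U x -> linear (fun v => K x u v w).
Proof.
move=> Ux a v v'; rewrite !curv_atE.
by rewrite (derive_linear_dir (dG u w Ux)) dGDZl // !GamDZl GamDZr rearr.
Qed.

Lemma curv_linear3 x u v : U x -> linear (K x u v).
Proof.
move=> Ux a w w'; rewrite !curv_atE.
by rewrite !dGDZr // !GamDZr rearr.
Qed.

Lemma smooth_Gam_apply A B : smooth_on U A -> smooth_on U B ->
  smooth_on U (fun x => Gm x (A x) (B x)).
Proof.
move=> sA sB.
have idl : linear (fun x : 'rV[R]_n => x) by [].
have idc : continuous (fun x : 'rV[R]_n => x) by move=> x; exact: cvg_id.
have lin1 x w : U x -> linear (fun v => Gm x v w) by move=> _; exact: Gam_linearr.
have lin2 x v : U x -> linear (Gm x v) by move=> _; exact: Gam_linearl.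
exact: (smooth_tensor2 oU idl idc lin1 lin2 sGam sA sB).
Qed.

Lemma smooth_curv u v w : smooth_on U (fun x => K x u v w).
Proof.
apply: (smooth_eq oU (f := fun x => 'D_u (fun y => Gm y v w) x + Gm x u (Gm x v w)
  - ('D_v (fun y => Gm y u w) x + Gm x v (Gm x u w)))).
  by move=> x _; rewrite curv_atE.
apply: (smoothB oU); apply: (smoothD oU);
  by [exact: smooth_D|apply: smooth_Gam_apply => //; exact: smooth_cst].
Qed.

Lemma curv_antisym x u v w : K x u v w = - K x v u w.
Proof. by rewrite !curv_atE opprB. Qed.

Lemma bianchi x u v w : U x -> K x u v w + K x v w u + K x w u v = 0.
Proof.
move=> Ux; rewrite !curv_atE.
have E a c d : 'D_a (fun y => Gm y c d) x = 'D_a (fun y => Gm y d c) x.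
  by apply: (eq_on_derive _ oU _ Ux) => y Uy; exact: (GamC oU sG uG symG).
rewrite (E w v u) (E u w v) (E v w u).
rewrite (GamC oU sG uG symG w u) // (GamC oU sG uG symG v u) // (GamC oU sG uG symG w v) //.
by apply/rowP => i; rewrite !mxE; ring.
Qed.

End Curvature.

Local Opaque Gam curv_at.

(* Covariant derivative of a section A of the pullback of the tangent bundle by
   [b], in the direction of the constant vector [a].  It is used with [b] the
   identity of R^n and with [b] the projection R^(n + n) -> R^n of TM; both are
   linear, so that [b a] is the image of [a] under the differential of [b]. *)
Definition cov (R : realType) (n k : nat) (G : 'rV[R]_n -> 'M[R]_n)
    (b : 'rV[R]_k -> 'rV[R]_n) (a : 'rV[R]_k) (A : 'rV[R]_k -> 'rV[R]_n) :
    'rV[R]_k -> 'rV[R]_n :=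
  fun z => 'D_a A z + Gam G (b z) (b a) (A z).

(* (nabla_p R)(u, v) w *)
Definition dcurv (R : realType) (n : nat) (G : 'rV[R]_n -> 'M[R]_n)
    (x p u v w : 'rV[R]_n) : 'rV[R]_n :=
  'D_p (fun y => curv_at G y u v w) x + Gam G x p (curv_at G x u v w)
  - curv_at G x (Gam G x p u) v w - curv_at G x u (Gam G x p v) w
  - curv_at G x u v (Gam G x p w).

(** For identities linear in derivative, connection and curvature terms: each such term becomes an
    arbitrary vector and [lra] works coordinatewise. Terms meant to cancel must first be brought to
    the same form. *)
Ltac vector_lra := repeat match goal with
  | |- context [@derive ?R ?V ?W ?f ?x ?v] => generalize (@derive R V W f x v); intro
  | |- context [@Gam ?R ?n ?G ?x ?v ?w] => generalize (@Gam R n G x v w); intro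
  | |- context [@cov ?R ?n ?k ?G ?b ?a ?A ?z] => generalize (@cov R n k G b a A z); intro
  | |- context [@dcurv ?R ?n ?G ?x ?p ?u ?v ?w] => generalize (@dcurv R n G x p u v w); intro
  | |- context [@curv_at ?R ?n ?G ?x ?u ?v ?w] => generalize (@curv_at R n G x u v w); intro
  end; apply/rowP => ?; rewrite !mxE; lra.

(** * Covariant derivatives along a base map *)

Section Cov.
Context {R : realType}.
Variables (n k : nat) (U : set 'rV[R]_n) (G : 'rV[R]_n -> 'M[R]_n).
Variable b : 'rV[R]_k -> 'rV[R]_n.
Hypothesis oU : open U.
Hypothesis sG : smooth_on U G.
Hypothesis uG : forall x, U x -> G x \in unitmx.
Hypothesis symG : forall x, U x -> (G x)^T = G x.
Hypothesis lb : linear b.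
Hypothesis cb : continuous b.

Local Notation Gm := (Gam G).
Local Notation K := (curv_at G).
Local Notation Ub := (b @^-1` U).
Local Notation cv := (cov G b).

Let oUb : open Ub := open_preimage oU cb.
Let sGam := smooth_Gam oU sG uG.
Let Gl1 x w : U x -> linear (fun v => Gm x v w).
Proof. by move=> _; exact: Gam_linearr. Qed.
Let Gl2 x v : U x -> linear (Gm x v).
Proof. by move=> _; exact: Gam_linearl. Qed.
Let Kl1 x v w : U x -> linear (fun u => K x u v w).
Proof. exact: (@curv_linear1 _ _ _ _ oU sG uG x v w). Qed.
Let Kl2 x u w : U x -> linear (fun v => K x u v w).
Proof. exact: (@curv_linear2 _ _ _ _ oU sG uG x u w). Qed.
Let Kl3 x u v : U x -> linear (K x u v).
Proof. exact: (@curv_linear3 _ _ _ _ oU sG uG x u v). Qed.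
Let sK := smooth_curv oU sG uG.

Lemma smooth_GamA A B : smooth_on Ub A -> smooth_on Ub B ->
  smooth_on Ub (fun z => Gm (b z) (A z) (B z)).
Proof. exact: (smooth_tensor2 oU lb cb Gl1 Gl2 sGam). Qed.

Lemma smooth_cov a A : smooth_on Ub A -> smooth_on Ub (cv a A).
Proof.
move=> sA; apply: (smoothD oUb); first exact: smooth_D.
by apply: smooth_GamA => //; exact: smooth_cst.
Qed.

Lemma smooth_curvA A B C : smooth_on Ub A -> smooth_on Ub B -> smooth_on Ub C ->
  smooth_on Ub (fun z => K (b z) (A z) (B z) (C z)).
Proof. exact: (smooth_tensor3 oU lb cb Kl1 Kl2 Kl3 sK). Qed.

Lemma cov_eq a A B z : (forall y, Ub y -> A y = B y) -> Ub z -> cv a A z = cv a B z.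
Proof. by move=> AB Uz; rewrite /cov (AB z Uz) (eq_on_derive a oUb AB Uz). Qed.

Lemma covD a A B z : smooth_on Ub A -> smooth_on Ub B -> Ub z ->
  cv a (fun y => A y + B y) z = cv a A z + cv a B z.
Proof.
move=> sA sB Uz; rewrite /cov (linear_add _ _ (Gam_linearl G _ _)) addrACA.
congr (_ + _); apply: (@deriveD _ _ _ A B).
  exact: smooth_derivable sA Uz.
exact: smooth_derivable sB Uz.
Qed.

Lemma covZ a r A z : smooth_on Ub A -> Ub z ->
  cv a (fun y => r *: A y) z = r *: cv a A z.
Proof.
move=> sA Uz; rewrite /cov (linear_scale _ _ (Gam_linearl G _ _)) scalerDr.
by congr (_ + _); apply: (@deriveZ _ _ _ A); exact: smooth_derivable sA Uz.
Qed.

Lemma covN a A z : smooth_on Ub A -> Ub z ->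
  cv a (fun y => - A y) z = - cv a A z.
Proof.
move=> sA Uz; rewrite -scaleN1r -covZ //.
by apply: cov_eq => // y _; rewrite scaleN1r.
Qed.

Lemma covB a A B z : smooth_on Ub A -> smooth_on Ub B -> Ub z ->
  cv a (fun y => A y - B y) z = cv a A z - cv a B z.
Proof.
move=> sA sB Uz; rewrite -covN // -covD //.
exact: (smoothN oUb).
Qed.

Lemma cov_linear_dir A z : smooth_on Ub A -> Ub z -> linear (fun a => cv a A z).
Proof.
move=> sA Uz r a a'; rewrite /cov.
have dA : differentiable A z by exact: smooth_differentiable sA Uz.
rewrite (derive_linear_dir dA) lb (Gam_linearr G _ _).
by rewrite scalerDr addrACA.
Qed.

Lemma cov_base a a' z : cv a (fun=> b a') z = Gm (b z) (b a) (b a').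
Proof. by rewrite /cov derive_cst add0r. Qed.

Lemma cov_curv a A B C z :
  smooth_on Ub A -> smooth_on Ub B -> smooth_on Ub C -> Ub z ->
  cv a (fun z => K (b z) (A z) (B z) (C z)) z =
  dcurv G (b z) (b a) (A z) (B z) (C z) + K (b z) (cv a A z) (B z) (C z)
  + K (b z) (A z) (cv a B z) (C z) + K (b z) (A z) (B z) (cv a C z).
Proof.
move=> sA sB sC Uz; rewrite /cov /dcurv (derive_tensor3 oU lb cb Kl1 Kl2 Kl3 sK a sA sB sC Uz).
rewrite (linear_add _ _ (Kl1 _ _ Uz)) (linear_add _ _ (Kl2 _ _ Uz)) (linear_add _ _ (Kl3 _ _ Uz)).
vector_lra.
Qed.

(** Constant directions commute, so there is no bracket term, and the pure second derivatives of [A]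
    cancel by Schwarz. What remains is the curvature of the base. *)
Lemma cov_comm a a' A z : smooth_on Ub A -> Ub z ->
  cv a (cv a' A) z - cv a' (cv a A) z = K (b z) (b a) (b a') (A z).
Proof.
move=> sA Uz; have Ubz : U (b z) by [].
have E c c' : cv c (cv c' A) z = 'D_c ('D_c' A) z
    + 'D_(b c) (fun x => Gm x (b c') (A z)) (b z) + Gm (b z) (b c') ('D_c A z)
    + Gm (b z) (b c) ('D_c' A z) + Gm (b z) (b c) (Gm (b z) (b c') (A z)).
  have l2 x : U x -> linear (Gm x (b c')) by exact: Gl2.
  have D1 := derive_tensor1 oU lb cb (T := fun x => Gm x (b c')) l2 (sGam (b c')) c sA Uz.
  have d1 : derivable ('D_c' A) z c by exact: smooth_derivable (smooth_D c' sA) Uz.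
  have d2 : derivable (fun y => Gm (b y) (b c') (A y)) z c.
    by apply: smooth_derivable Uz; apply: smooth_GamA => //; exact: smooth_cst.
  rewrite /cov (deriveD d1 d2) D1 (linear_add _ _ (Gam_linearl G _ _)); vector_lra.
rewrite curv_atE !E (derive_swap a' a oUb sA Uz); vector_lra.
Qed.

Lemma cov_form a A B z : smooth_on Ub A -> smooth_on Ub B -> Ub z ->
  'D_a (fun z => form (G (b z)) (A z) (B z)) z =
  form (G (b z)) (cv a A z) (B z) + form (G (b z)) (A z) (cv a B z).
Proof.
move=> sA sB Uz; rewrite (derive_tensor2 oU lb cb (T := fun x u v => form (G x) u v)) //.
- rewrite (derive_form oU sG uG symG) // /cov.
  rewrite (linear_add _ _ (form_linearl _ _)) (linear_add _ _ (form_linearr _ _)).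
  by rewrite /=; ring.
- by move=> x w Ux; exact: form_linearl.
- by move=> x v Ux; exact: form_linearr.
- exact: smooth_form_cst.
Qed.

End Cov.

Lemma linear_idr (R : realType) n : linear (fun x : 'rV[R]_n => x).
Proof. by []. Qed.

Lemma continuous_idr (R : realType) n : continuous (fun x : 'rV[R]_n => x).
Proof. by move=> x; exact: cvg_id. Qed.

(** * Metric symmetries of the curvature and its commutation with phi *)

Section CurvatureSymmetries.
Context {R : realType}.
Variables (n : nat) (U : set 'rV[R]_n) (G : 'rV[R]_n -> 'M[R]_n).
Hypothesis oU : open U.
Hypothesis sG : smooth_on U G.
Hypothesis uG : forall x, U x -> G x \in unitmx.
Hypothesis symG : forall x, U x -> (G x)^T = G x.

Local Notation K := (curv_at G).
Local Notation nab := (cov G (fun x => x)).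

(** The second derivatives of the function g(w, c) commute; expanded by metric compatibility, their
    commutator is the sum of the two curvature pairings. *)
Lemma curv_skew x u v w c : U x ->
  form (G x) (K x u v w) c = - form (G x) w (K x u v c).
Proof.
move=> Ux; have lid := @linear_idr R n; have cid := @continuous_idr R n.
have sc (a : 'rV[R]_n) : smooth_on U (fun=> a) by exact: smooth_cst.
have sn p a : smooth_on U (nab p (fun=> a)) by exact: smooth_cov.
have D2 p q : 'D_p ('D_q (fun y => form (G y) w c)) x =
    form (G x) (nab p (nab q (fun=> w)) x) c + form (G x) (nab q (fun=> w) x) (nab p (fun=> c) x)
    + (form (G x) (nab p (fun=> w) x) (nab q (fun=> c) x) + form (G x) w (nab p (nab q (fun=> c)) x)).
  have E1 y : U y -> 'D_q (fun y => form (G y) w c) y =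
    form (G y) (nab q (fun=> w) y) c + form (G y) w (nab q (fun=> c) y).
    exact: (cov_form oU sG uG symG lid cid q (sc w) (sc c)).
  rewrite (eq_on_derive p oU E1 Ux).
  have F1 := cov_form oU sG uG symG lid cid p (sn q w) (sc c) Ux.
  have F2 := cov_form oU sG uG symG lid cid p (sc w) (sn q c) Ux.
  have sf A B : smooth_on U A -> smooth_on U B -> smooth_on U (fun y => form (G y) (A y) (B y)).
    apply: (smooth_tensor2 oU lid cid (T := fun y a b => form (G y) a b)).
    - by move=> y b _; exact: form_linearl.
    - by move=> y b _; exact: form_linearr.
    - exact: smooth_form_cst.
  have d1 : derivable (fun y => form (G y) (nab q (fun=> w) y) c) x p.
    exact: smooth_derivable (sf _ _ (sn q w) (sc c)) Ux.
  have d2 : derivable (fun y => form (G y) w (nab q (fun=> c) y)) x p.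
    exact: smooth_derivable (sf _ _ (sc w) (sn q c)) Ux.
  by rewrite (deriveD d1 d2) F1 F2.
have Kw := cov_comm oU sG uG lid cid u v (sc w) Ux.
have Kc := cov_comm oU sG uG lid cid u v (sc c) Ux.
have sf : smooth_on U (fun y => form (G y) w c) by exact: smooth_form_cst.
have := derive_swap1 u v oU sf Ux; rewrite !D2 => E.
rewrite -Kw -Kc !(linear_sub _ _ (form_linearl _ _)) !(linear_sub _ _ (form_linearr _ _)).
move: E; set x1 := form _ (nab v _ _) _; set x2 := form _ (nab u _ _) _; lra.
Qed.

(** The classical combination of four Bianchi identities with the two antisymmetries; with [r]
    abstracted it is linear arithmetic. *)
Lemma curv_pair x u v w c : U x ->
  form (G x) (K x u v w) c = form (G x) (K x w c u) v.
Proof.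
move=> Ux; pose r a b c d := form (G x) (K x a b c) d.
have A1 a b c' d : r a b c' d = - r b a c' d.
  by rewrite /r curv_antisym (linear_opp _ (form_linearl _ _)).
have A2 a b c' d : r a b c' d = - r a b d c'.
  by rewrite /r curv_skew // form_sym ?symG.
have B a b c' d : r a b c' d + r b c' a d + r c' a b d = 0.
  rewrite /r -!(linear_add _ _ (form_linearl _ _)) (bianchi oU sG uG symG) //.
  exact: linear_0 (form_linearl _ _).
change (r u v w c = r w c u v); clearbody r.
have := B u v w c; have := B v w c u; have := B w c u v; have := B c u v w.
have := A2 v w c u; have := A2 w c v u; have := A1 c v w u; have := A1 c u w v.
have := A2 u c w v; have := A1 u w c v; have := A2 w u c v; have := A1 c u v w.
have := A2 u v c w; have := A2 v c u w; lra.
Qed.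

Variable Phi : 'rV[R]_n -> 'M[R]_n.
Hypothesis sPhi : smooth_on U Phi.
Hypothesis pure : forall x, U x -> forall v w,
  form (G x) (v *m Phi x) w = form (G x) v (w *m Phi x).
Hypothesis parallel : forall x, U x -> forall u w,
  'D_u (fun y => w *m Phi y) x + Gam G x u (w *m Phi x) = Gam G x u w *m Phi x.

Lemma mulmx_linear p (A : 'M[R]_(n, p)) : linear (fun v : 'rV[R]_n => v *m A).
Proof. by move=> a u v; rewrite mulmxDl scalemxAl. Qed.

Lemma smooth_endo (v : 'rV[R]_n) : smooth_on U (fun x => v *m Phi x).
Proof.
apply: smooth_mx => // i j.
apply: (smooth_eq oU (f := fun x => \sum_l v i l * Phi x l j)).
  by move=> x _; rewrite mxE.
apply: smooth_sum => // l; apply: smoothM => //; first exact: smooth_cst.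
exact: smooth_entry.
Qed.

Section Base.
Variables (k : nat) (b : 'rV[R]_k -> 'rV[R]_n).
Hypothesis lb : linear b.
Hypothesis cb : continuous b.

Lemma smooth_endoA (A : 'rV[R]_k -> 'rV[R]_n) : smooth_on (b @^-1` U) A ->
  smooth_on (b @^-1` U) (fun z => A z *m Phi (b z)).
Proof.
apply: (smooth_tensor1 oU lb cb (T := fun x (v : 'rV[R]_n) => v *m Phi x)); last exact: smooth_endo.
by move=> x _; exact: mulmx_linear.
Qed.

Lemma cov_endo a (A : 'rV[R]_k -> 'rV[R]_n) z : smooth_on (b @^-1` U) A -> (b @^-1` U) z ->
  cov G b a (fun z => A z *m Phi (b z)) z = cov G b a A z *m Phi (b z).
Proof.
move=> sA Uz; have lP x : U x -> linear (fun v : 'rV[R]_n => v *m Phi x).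
  by move=> _; exact: mulmx_linear.
have D := derive_tensor1 oU lb cb (T := fun x (v : 'rV[R]_n) => v *m Phi x) lP smooth_endo a sA Uz.
by rewrite /cov D addrAC parallel // addrC -mulmxDl.
Qed.
End Base.

(** A parallel [Phi] passes through both covariant derivatives, hence through their commutator. *)
Lemma curv_endo x u v w : U x -> K x u v (w *m Phi x) = K x u v w *m Phi x.
Proof.
move=> Ux; have lid := @linear_idr R n; have cid := @continuous_idr R n.
have sc (a : 'rV[R]_n) : smooth_on U (fun=> a) by exact: smooth_cst.
have sn p a : smooth_on U (nab p (fun=> a)) by exact: smooth_cov.
have sw : smooth_on U (fun y => w *m Phi y) by exact: smooth_endo.
have D2 p q : nab p (nab q (fun y => w *m Phi y)) x = nab p (nab q (fun=> w)) x *m Phi x.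
  rewrite -(cov_endo lid cid p (sn q w) Ux).
  apply: (cov_eq (U := U)) => // y Uy.
  exact: (cov_endo lid cid q (sc w) Uy).
have E1 := cov_comm oU sG uG lid cid u v sw Ux.
have E2 := cov_comm oU sG uG lid cid u v (sc w) Ux.
apply: etrans (esym E1) _; rewrite (D2 u v) (D2 v u) -mulmxBl.
by congr (_ *m _).
Qed.

(* This turns the curvature terms of Koszul's formula into horizontal vectors. *)
Lemma curv_endo_pair x u v w c : U x ->
  form (G x) (K x u v w) (c *m Phi x) = form (G x) (K x (w *m Phi x) c u) v.
Proof. by move=> Ux; rewrite -pure // -curv_endo // curv_pair. Qed.

End CurvatureSymmetries.

(** * The phi-Sasaki metric *)

Section RowMx.
Context {R : realType}.
Variables (V : normedModType R) (U : set V) (n1 n2 : nat).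
Hypothesis oU : open U.

Lemma smooth_row_mx (A : V -> 'rV[R]_n1) (B : V -> 'rV[R]_n2) :
  smooth_on U A -> smooth_on U B -> smooth_on U (fun z => row_mx (A z) (B z)).
Proof.
move=> sA sB; apply: smooth_mx => // i j; case: (split_ordP j) => l ->.
  by apply: smooth_eq (smooth_entry oU i l sA) => // y _; rewrite row_mxEl.
by apply: smooth_eq (smooth_entry oU i l sB) => // y _; rewrite row_mxEr.
Qed.

Lemma derive_row_mx (A : V -> 'rV[R]_n1) (B : V -> 'rV[R]_n2) a z :
  smooth_on U A -> smooth_on U B -> U z ->
  'D_a (fun z => row_mx (A z) (B z)) z = row_mx ('D_a A z) ('D_a B z).
Proof.
move=> sA sB Uz; have sAB := smooth_row_mx sA sB.
have dA : derivable A z a by exact: smooth_derivable sA Uz.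
have dB : derivable B z a by exact: smooth_derivable sB Uz.
have dAB : derivable (fun z => row_mx (A z) (B z)) z a by exact: smooth_derivable sAB Uz.
apply/matrixP => i j; rewrite -(derive_entry i j dAB); case: (split_ordP j) => l ->.
  rewrite row_mxEl -(derive_entry i l dA); apply: eq_on_derive Uz => // y _.
  by rewrite row_mxEl.
rewrite row_mxEr -(derive_entry i l dB); apply: eq_on_derive Uz => // y _.
by rewrite row_mxEr.
Qed.
End RowMx.

Section Projections.
Context {R : realType} {n : nat}.

Lemma lsubmx_linear : linear (lsubmx : 'rV[R]_(n + n) -> 'rV[R]_n).
Proof. by move=> a u v; rewrite linearP. Qed.

Lemma rsubmx_linear : linear (rsubmx : 'rV[R]_(n + n) -> 'rV[R]_n).
Proof. by move=> a u v; rewrite linearP. Qed.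

Lemma smooth_rsubmx (V : set 'rV[R]_(n + n)) : open V ->
  smooth_on V (rsubmx : 'rV[R]_(n + n) -> 'rV[R]_n).
Proof.
by move=> oV; exact: (smooth_apply_linear oV rsubmx_linear (smooth_id oV)).
Qed.

Lemma derive_rsubmx (a y : 'rV[R]_(n + n)) :
  'D_a (rsubmx : 'rV[R]_(n + n) -> 'rV[R]_n) y = rsubmx a.
Proof.
have oT : open [set: 'rV[R]_(n + n)] by exact: openT.
have := derive_apply_linear oT a rsubmx_linear (smooth_id oT) (I : setT y).
by rewrite derive_id.
Qed.
End Projections.

(* The horizontal lift of [p] plus the vertical lift of [q]. *)
Definition hv (R : realType) (n : nat) (G : 'rV[R]_n -> 'M[R]_n)
    (y : 'rV[R]_(n + n)) (p q : 'rV[R]_n) : 'rV[R]_(n + n) :=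
  row_mx p (q - Gam G (lsubmx y) p (rsubmx y)).

Section HV.
Context {R : realType}.
Variables (n : nat) (G : 'rV[R]_n -> 'M[R]_n).
Implicit Types y a : 'rV[R]_(n + n).

Lemma connector_hv y p q : connector G y (hv G y p q) = q.
Proof. by rewrite /connector /hv row_mxKl row_mxKr subrK. Qed.

Lemma lsubmx_hv y p q : lsubmx (hv G y p q) = p.
Proof. exact: row_mxKl. Qed.

Lemma hvE y a : a = hv G y (lsubmx a) (connector G y a).
Proof. by rewrite /hv /connector addrK hsubmxK. Qed.

Lemma hvD y p q p' q' : hv G y p q + hv G y p' q' = hv G y (p + p') (q + q').
Proof.
rewrite /hv add_row_mx (linear_add _ _ (Gam_linearr G _ _)); congr row_mx; vector_lra.
Qed.

Lemma hvZ y r p q : r *: hv G y p q = hv G y (r *: p) (r *: q).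
Proof.
rewrite /hv scale_row_mx (linear_scale _ _ (Gam_linearr G _ _)); congr row_mx.
by rewrite scalerBr.
Qed.

Lemma hvN y p q : - hv G y p q = hv G y (- p) (- q).
Proof. by rewrite -scaleN1r hvZ !scaleN1r. Qed.

Lemma hvB y p q p' q' : hv G y p q - hv G y p' q' = hv G y (p - p') (q - q').
Proof. by rewrite hvN hvD. Qed.

(** This splits the sesqui-harmonic equation into its horizontal and vertical halves. *)
Lemma hv_eq0 y p q : hv G y p q = 0 <-> p = 0 /\ q = 0.
Proof.
split=> [E|[-> ->]].
  have p0 : p = 0 by rewrite -(lsubmx_hv y p q) E linear0.
  split=> //; rewrite -(connector_hv y p q) E /connector !linear0 add0r.
  exact: linear_0 (Gam_linearr G _ _).
by rewrite /hv (linear_0 (Gam_linearr G _ _)) subr0 row_mx0.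
Qed.

Lemma hv_sum I (r : seq I) y (p q : I -> 'rV[R]_n) :
  \sum_(i <- r) hv G y (p i) (q i) = hv G y (\sum_(i <- r) p i) (\sum_(i <- r) q i).
Proof.
elim: r => [|i r IH]; last by rewrite !big_cons IH hvD.
by rewrite !big_nil; apply/esym/hv_eq0.
Qed.

End HV.

(** [phi_sasaki] in a single chart, freed of the atlas so that the local theory lives on an open set
    of R^n; the two are convertible. *)
Definition sasaki (R : realType) (n : nat) (G Phi : 'rV[R]_n -> 'M[R]_n)
    (y : 'rV[R]_(n + n)) : 'M[R]_(n + n) :=
  \matrix_(i, j) phi_sasaki_form G Phi y (delta_mx 0 i) (delta_mx 0 j).

(* Horizontal and vertical components of the derivative, for the phi-Sasaki
   connection, of the field with components [A] and [B] along
   z |-> (b z, s z). *)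
Definition covh (R : realType) (n k : nat) (G Phi : 'rV[R]_n -> 'M[R]_n)
    (b s : 'rV[R]_k -> 'rV[R]_n) (a : 'rV[R]_k) (A B : 'rV[R]_k -> 'rV[R]_n)
    (z : 'rV[R]_k) : 'rV[R]_n :=
  cov G b a A z + 2^-1 *: curv_at G (b z) (s z *m Phi (b z)) (cov G b a s z) (A z)
  + 2^-1 *: curv_at G (b z) (s z *m Phi (b z)) (B z) (b a).

Definition covv (R : realType) (n k : nat) (G : 'rV[R]_n -> 'M[R]_n)
    (b s : 'rV[R]_k -> 'rV[R]_n) (a : 'rV[R]_k) (A B : 'rV[R]_k -> 'rV[R]_n)
    (z : 'rV[R]_k) : 'rV[R]_n :=
  cov G b a B z - 2^-1 *: curv_at G (b z) (b a) (A z) (s z).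

(** * Levi-Civita connection of the phi-Sasaki metric *)

Section Sasaki.
Context {R : realType}.
Variables (n : nat) (U : set 'rV[R]_n) (G Phi : 'rV[R]_n -> 'M[R]_n).
Hypothesis oU : open U.
Hypothesis sG : smooth_on U G.
Hypothesis uG : forall x, U x -> G x \in unitmx.
Hypothesis symG : forall x, U x -> (G x)^T = G x.
Hypothesis posG : forall x, U x -> forall v, v != 0 -> 0 < form (G x) v v.
Hypothesis sPhi : smooth_on U Phi.
Hypothesis pure : forall x, U x -> forall v w,
  form (G x) (v *m Phi x) w = form (G x) v (w *m Phi x).
Hypothesis parallel : forall x, U x -> forall u w,
  'D_u (fun y => w *m Phi y) x + Gam G x u (w *m Phi x) = Gam G x u w *m Phi x.
Hypothesis invol : forall x, U x -> Phi x *m Phi x = 1%:M.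

Local Notation K := (curv_at G).
Local Notation H := (sasaki G Phi).
Local Notation pr := (lsubmx : 'rV[R]_(n + n) -> 'rV[R]_n).
Local Notation UT := (pr @^-1` U).
Local Notation cn := (connector G).

Let lpr : linear pr := @lsubmx_linear R n.
Let cpr : continuous pr. Proof. exact: continuous_lsubmx. Qed.
Let oUT : open UT := open_preimage oU cpr.

Lemma sasakiE y a b : form (H y) a b =
  form (G (pr y)) (pr a) (pr b) + form (G (pr y)) (cn y a) (cn y b *m Phi (pr y)).
Proof.
rewrite /sasaki bilinear_formE // => *; first exact: phi_sasaki_formDZl.
exact: phi_sasaki_formDZr.
Qed.

Lemma sasaki_hv y p q b : form (H y) (hv G y p q) b =
  form (G (pr y)) p (pr b) + form (G (pr y)) q (cn y b *m Phi (pr y)).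
Proof. by rewrite sasakiE lsubmx_hv connector_hv. Qed.

Lemma sasaki_sym y : UT y -> (H y)^T = H y.
Proof.
move=> Uy; apply/matrixP => i j; rewrite !mxE /phi_sasaki_form.
congr (_ + _); first by rewrite form_sym // symG.
by rewrite -pure // form_sym // symG.
Qed.

Lemma sasaki_unit y : UT y -> H y \in unitmx.
Proof.
move=> Uy; rewrite -row_free_unit; apply: inj_row_free => v v0.
have fv b : form (H y) v b = 0 by rewrite /form v0 mul0mx mxE.
have g0 p : form (G (pr y)) p p = 0 -> p = 0.
  move=> E; apply/eqP; apply: contraT => /(posG Uy); rewrite E ltxx //.
have form0r p : form (G (pr y)) p 0 = 0 by rewrite /form trmx0 mulmx0 mxE.
rewrite (hvE G y v); apply/hv_eq0; split; apply: g0.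
  have := fv (hv G y (pr v) 0).
  by rewrite sasakiE lsubmx_hv connector_hv mul0mx form0r addr0.
(* The metric is indefinite on vertical vectors. Testing against [Phi] of the vertical part makes
   [Phi] appear twice, and as its square is 1 the positivity of [G] applies. *)
have := fv (hv G y 0 (cn y v *m Phi (pr y))).
rewrite sasakiE lsubmx_hv connector_hv form0r add0r -mulmxA invol //.
by rewrite mulmx1.
Qed.

(** The connector differentiates the tautological section of the pullback of TM to itself, so
    [cov_comm] governs the derivatives of the connector. *)
Lemma connectorE y a : cn y a = cov G pr a rsubmx y.
Proof. by rewrite /cov derive_rsubmx. Qed.

Lemma smooth_connector a : smooth_on UT (fun y => cn y a).
Proof.
apply: (smooth_eq oUT (f := cov G pr a rsubmx)); first by move=> y _; rewrite connectorE.
by apply: (smooth_cov oU sG uG lpr cpr); exact: smooth_rsubmx.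
Qed.

Lemma smooth_sasaki : smooth_on UT H.
Proof.
have scst m (v : 'rV[R]_m) : smooth_on UT (fun=> v) by exact: smooth_cst.
have sf A B : smooth_on UT A -> smooth_on UT B ->
    smooth_on UT (fun y => form (G (pr y)) (A y) (B y)).
  apply: (smooth_tensor2 oU lpr cpr (T := fun y a b => form (G y) a b)).
  - by move=> y b _; exact: form_linearl.
  - by move=> y b _; exact: form_linearr.
  - exact: smooth_form_cst.
apply: smooth_mx => // i j.
apply: (smooth_eq oUT (f := fun y => phi_sasaki_form G Phi y (delta_mx 0 i) (delta_mx 0 j))).
  by move=> y _; rewrite mxE.
apply: (smoothD oUT); apply: sf => //; first exact: smooth_connector.
by apply: (smooth_endoA oU sPhi lpr cpr); exact: smooth_connector.
Qed.

Lemma derive_sasaki a w c y : UT y ->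
  'D_a (fun y => form (H y) w c) y =
  form (G (pr y)) (Gam G (pr y) (pr a) (pr w)) (pr c) +
  form (G (pr y)) (pr w) (Gam G (pr y) (pr a) (pr c)) +
  (form (G (pr y)) (cov G pr a (fun y => cn y w) y) (cn y c *m Phi (pr y)) +
   form (G (pr y)) (cn y w) (cov G pr a (fun y => cn y c) y *m Phi (pr y))).
Proof.
move=> Uy; have scst (v : 'rV[R]_n) : smooth_on UT (fun=> v) by exact: smooth_cst.
have sc := smooth_connector.
have scP : smooth_on UT (fun y => cn y c *m Phi (pr y)).
  by apply: (smooth_endoA oU sPhi lpr cpr).
have sf A B : smooth_on UT A -> smooth_on UT B ->
    smooth_on UT (fun y => form (G (pr y)) (A y) (B y)).
  apply: (smooth_tensor2 oU lpr cpr (T := fun y a b => form (G y) a b)).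
  - by move=> y' b _; exact: form_linearl.
  - by move=> y' b _; exact: form_linearr.
  - exact: smooth_form_cst.
have E y' : UT y' -> form (H y') w c = form (G (pr y')) (pr w) (pr c) +
    form (G (pr y')) (cn y' w) (cn y' c *m Phi (pr y')) by move=> _; exact: sasakiE.
rewrite (eq_on_derive a oUT E Uy).
have d1 : derivable (fun y => form (G (pr y)) (pr w) (pr c)) y a.
  by apply: smooth_derivable Uy; apply: (sf (fun=> pr w) (fun=> pr c)).
have d2 : derivable (fun y => form (G (pr y)) (cn y w) (cn y c *m Phi (pr y))) y a.
  by apply: smooth_derivable Uy; apply: sf.
have F1 := cov_form oU sG uG symG lpr cpr a (scst (pr w)) (scst (pr c)) Uy.
have F2 := cov_form oU sG uG symG lpr cpr a (sc w) scP Uy.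
have F3 := cov_endo oU sPhi parallel lpr cpr a (sc c) Uy.
by rewrite (deriveD d1 d2) F1 F2 F3 !cov_base.
Qed.

(** Both sides are tested against an arbitrary [c] with Koszul's formula. The derivative of the
    connector in two directions is not symmetric: by [DC] the defect is the curvature applied to the
    fibre coordinate [u]. Paired with the vertical part of [c] it gives the vertical curvature term;
    paired with the vertical parts of [a] and [w] it becomes, through [KP], the two horizontal
    ones. *)
Lemma Gam_sasaki y a w : UT y -> Gam H y a w = hv G y
  (Gam G (pr y) (pr a) (pr w)
   + 2^-1 *: K (pr y) (rsubmx y *m Phi (pr y)) (cn y w) (pr a)
   + 2^-1 *: K (pr y) (rsubmx y *m Phi (pr y)) (cn y a) (pr w))
  (cov G pr a (fun y => cn y w) y - 2^-1 *: K (pr y) (pr a) (pr w) (rsubmx y)).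
Proof.
move=> Uy; apply: (form_inj (sasaki_unit Uy)) => c.
rewrite (koszul oUT smooth_sasaki sasaki_unit sasaki_sym) // !derive_sasaki //.
rewrite sasaki_hv.
set x := pr y; set u := rsubmx y; have Ux : U x by [].
set g := form (G x).
have gl := form_linearl (G x).
have gD v1 v2 b : g (v1 + v2) b = g v1 b + g v2 b by exact: linear_add (gl b).
have gN v b : g (- v) b = - g v b by exact: linear_opp (gl b).
have gZ r v b : g (r *: v) b = r * g v b by exact: linear_scale (gl b).
have gC v b : g v b = g b v by rewrite /g form_sym ?symG.
have gP v b : g v (b *m Phi x) = g b (v *m Phi x) by rewrite gC /g pure.
have DC p q : cov G pr p (fun y => cn y q) y =
    cov G pr q (fun y => cn y p) y + K x (pr p) (pr q) u.
  have cE p' q' : cov G pr p' (fun y => cn y q') y = cov G pr p' (cov G pr q' rsubmx) y.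
    by congr (cov G pr p' _ y); apply/funext => y'; exact: connectorE.
  have := cov_comm oU sG uG lpr cpr p q (smooth_rsubmx oUT) Uy.
  by rewrite !cE => <-; rewrite addrC subrK.
have KP p q v : g (K x (pr p) (pr q) u) (v *m Phi x) = g (K x (u *m Phi x) v (pr p)) (pr q).
  exact: (curv_endo_pair oU sG uG symG sPhi pure parallel).
move: (DC w a) (DC a c) (DC w c) (KP a c (cn y w)) (KP w c (cn y a)).
move: (cov G pr a (fun y => cn y w) y) (cov G pr w (fun y => cn y a) y)
  (cov G pr a (fun y => cn y c) y) (cov G pr c (fun y => cn y a) y)
  (cov G pr w (fun y => cn y c) y) (cov G pr c (fun y => cn y w) y)
  => Daw Dwa Dac Dca Dwc Dcw.
move: (cn y a) (cn y w) (cn y c) => ca cw cc -> -> ->.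
clear DC KP gl; clearbody g x u; move: (pr a) (pr w) (pr c) => pa pw pc K1 K2.
rewrite (GamC oU sG uG symG pw pa Ux) (GamC oU sG uG symG pc pa Ux).
rewrite (GamC oU sG uG symG pc pw Ux) (curv_antisym G x pw pa u).
move: K1 K2; move: (Gam G x pa pw) (Gam G x pa pc) (Gam G x pw pc) => Gaw Gac Gwc.
move: (K x pa pc u) (K x pw pc u) (K x pa pw u) => Kac Kwc Kaw.
move: (K x (u *m Phi x) cw pa) (K x (u *m Phi x) ca pw) => Kw Ka K1 K2.
(* [gP] exchanges the two vectors around [Phi], so that [lra] meets each mixed pairing in one form
   only. *)
rewrite (gP cw (Dca + _)) (gP ca (Dcw + _)) (gP ca Dcw) !gD !gN !gZ K1 K2.
rewrite (gC pw Gac).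
lra.
Qed.

Section Along.
Variables (k : nat) (b s : 'rV[R]_k -> 'rV[R]_n) (f : 'rV[R]_k -> 'rV[R]_(n + n)).
Hypothesis lb : linear b.
Hypothesis cb : continuous b.
Local Notation Ub := (b @^-1` U).
Hypothesis ss : smooth_on Ub s.
Hypothesis fE : forall z, Ub z -> f z = row_mx (b z) (s z).

Let oUb : open Ub := open_preimage oU cb.

Lemma smooth_linear_base : smooth_on Ub b.
Proof. exact: (smooth_apply_linear oUb lb (smooth_id oUb)). Qed.

Lemma derive_linear_base a z : Ub z -> 'D_a b z = b a.
Proof.
move=> Uz; have := derive_apply_linear oUb a lb (smooth_id oUb) Uz.
by rewrite derive_id.
Qed.

Lemma dmap_hv (X : 'rV[R]_k -> 'rV[R]_k) z : Ub z ->
  dmap f X z = hv G (f z) (b (X z)) (cov G b (X z) s z).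
Proof.
move=> Uz; rewrite /dmap (eq_on_derive (X z) oUb fE Uz) (derive_row_mx oUb) //;
  last exact: smooth_linear_base.
rewrite derive_linear_base // fE // /hv row_mxKl row_mxKr /cov; congr row_mx; vector_lra.
Qed.

(** [Gam_sasaki] is used with the value [W z] frozen as a constant vector of TM. Its connector still
    varies with the point, and that variation cancels the derivative of the Christoffel term hidden
    in the second component of [W]. *)
Lemma pullback_hv (X : 'rV[R]_k -> 'rV[R]_k) W A B z :
  (forall z, Ub z -> W z = hv G (f z) (A z) (B z)) ->
  smooth_on Ub A -> smooth_on Ub B -> Ub z ->
  pullback_nabla H f X W z =
  hv G (f z) (covh G Phi b s (X z) A B z) (covv G b s (X z) A B z).
Proof.
move=> WE sA sB Uz; have Ufz : UT (f z) by rewrite /= fE // row_mxKl.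
have fl : pr (f z) = b z by rewrite fE // row_mxKl.
have fr : rsubmx (f z) = s z by rewrite fE // row_mxKr.
rewrite /pullback_nabla (Gam_sasaki _ _ Ufz) dmap_hv // !connector_hv !lsubmx_hv.
rewrite WE // !connector_hv !lsubmx_hv fl fr.
set a := X z.
have sGAs : smooth_on Ub (fun z => Gam G (b z) (A z) (s z)).
  exact: (smooth_GamA oU sG uG lb cb sA ss).
have W'E z' : Ub z' -> W z' = row_mx (A z') (B z' - Gam G (b z') (A z') (s z')).
  by move=> Uz'; rewrite WE // /hv fE // row_mxKl row_mxKr.
have dB : derivable B z a by exact: smooth_derivable sB Uz.
have dG : derivable (fun z => Gam G (b z) (A z) (s z)) z a by exact: smooth_derivable sGAs Uz.
rewrite (eq_on_derive a oUb W'E Uz) (derive_row_mx oUb _ sA) //; last exact: smoothB.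
rewrite (deriveB dB dG).
have l1 x w : U x -> linear (fun v => Gam G x v w) by move=> _; exact: Gam_linearr.
have l2 x v : U x -> linear (Gam G x v) by move=> _; exact: Gam_linearl.
have sGam := smooth_Gam oU sG uG.
rewrite (derive_tensor2 oU lb cb l1 l2 sGam a sA ss Uz).
pose e := hv G (f z) (b a) (cov G b a s z); pose w := hv G (f z) (A z) (B z).
(* With [w] constant only the Christoffel term of the connector is differentiated, both along the
   base and, through [rsubmx], along the fibre. *)
have cnE : cov G pr e (fun y => connector G y w) (f z) =
    'D_(b a) (fun x => Gam G x (A z) (s z)) (b z) + Gam G (b z) (A z) ('D_a s z)
    + Gam G (b z) (b a) (B z).
  rewrite /cov /w connector_hv fl lsubmx_hv; congr (_ + _).
  have sr := smooth_rsubmx oUT.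
  have lA x : U x -> linear (Gam G x (A z)) by exact: l2.
  have D := derive_tensor1 oU lpr cpr (T := fun x => Gam G x (A z)) lA (sGam (A z)) e sr Ufz.
  have d2 : derivable (fun y => Gam G (pr y) (A z) (rsubmx y)) (f z) e.
    by apply: smooth_derivable Ufz; apply: (smooth_GamA oU sG uG lpr cpr) => //; exact: smooth_cst.
  have d1 : derivable (fun y : 'rV[R]_(n + n) => rsubmx (hv G (f z) (A z) (B z)) : 'rV[R]_n) (f z) e.
    exact: derivable_cst.
  have E y : connector G y (hv G (f z) (A z) (B z)) =
      rsubmx (hv G (f z) (A z) (B z)) + Gam G (pr y) (A z) (rsubmx y).
    by rewrite /connector lsubmx_hv.
  have -> : (fun y => connector G y (hv G (f z) (A z) (B z))) =
    (fun y => rsubmx (hv G (f z) (A z) (B z)) + Gam G (pr y) (A z) (rsubmx y)).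
    by apply/funext.
  rewrite (deriveD d1 d2) D derive_cst add0r derive_rsubmx fl fr {1}/e lsubmx_hv.
  by congr (_ + Gam G _ _ _); rewrite /e /hv row_mxKr fl fr /cov addrK.
rewrite cnE /hv fl fr add_row_mx /covh /covv; congr row_mx.
  by rewrite /cov; vector_lra.
rewrite /cov !(linear_add _ _ (Gam_linearr G _ _)); vector_lra.
Qed.

End Along.
End Sasaki.

(** The shape of [covh]; the next lemma has that of [covv]. Both push a curvature slot through an
    inner derivative. *)
Lemma linear_half_add (R : realType) (V W : lmodType R) (f : V -> W) u v w : linear f ->
  f (u + 2^-1 *: v + 2^-1 *: w) = f u + 2^-1 *: f v + 2^-1 *: f w.
Proof.
by move=> lf; rewrite !(linear_add _ _ lf) !(linear_scale _ _ lf).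
Qed.

Lemma linear_half_sub (R : realType) (V W : lmodType R) (f : V -> W) u v : linear f ->
  f (u - 2^-1 *: v) = f u - 2^-1 *: f v.
Proof. by move=> lf; rewrite (linear_sub _ _ lf) (linear_scale _ _ lf). Qed.

(** * Second covariant derivatives on TM *)

Section Second.
Context {R : realType}.
Variables (n : nat) (U : set 'rV[R]_n) (G Phi : 'rV[R]_n -> 'M[R]_n).
Hypothesis oU : open U.
Hypothesis sG : smooth_on U G.
Hypothesis uG : forall x, U x -> G x \in unitmx.
Hypothesis sPhi : smooth_on U Phi.
Hypothesis parallel : forall x, U x -> forall u w,
  'D_u (fun y => w *m Phi y) x + Gam G x u (w *m Phi x) = Gam G x u w *m Phi x.
Variables (k : nat) (b s : 'rV[R]_k -> 'rV[R]_n).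
Hypothesis lb : linear b.
Hypothesis cb : continuous b.
Local Notation Ub := (b @^-1` U).
Hypothesis ss : smooth_on Ub s.
Local Notation K := (curv_at G).
Local Notation c := (cov G b).
Local Notation F v z := (v *m Phi (b z)).

Let oUb : open Ub := open_preimage oU cb.

Let sF (A : 'rV[R]_k -> 'rV[R]_n) : smooth_on Ub A -> smooth_on Ub (fun z => F (A z) z).
Proof. exact: (smooth_endoA oU sPhi lb cb). Qed.
Let sc a A : smooth_on Ub A -> smooth_on Ub (c a A).
Proof. exact: (smooth_cov oU sG uG lb cb a). Qed.
Let scst (v : 'rV[R]_n) : smooth_on Ub (fun=> v).
Proof. exact: smooth_cst. Qed.
Let sK A B C : smooth_on Ub A -> smooth_on Ub B -> smooth_on Ub C ->
  smooth_on Ub (fun z => K (b z) (A z) (B z) (C z)).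
Proof. exact: (smooth_curvA oU sG uG lb cb). Qed.

Lemma smooth_covh a A B : smooth_on Ub A -> smooth_on Ub B ->
  smooth_on Ub (covh G Phi b s a A B).
Proof.
move=> sA sB; apply: (smoothD oUb); first apply: (smoothD oUb); first exact: sc.
  by apply: (smoothZ oUb); apply: sK => //; [exact: sF|exact: sc].
by apply: (smoothZ oUb); apply: sK => //; exact: sF.
Qed.

Lemma smooth_covv a A B : smooth_on Ub A -> smooth_on Ub B ->
  smooth_on Ub (covv G b s a A B).
Proof.
move=> sA sB; apply: (smoothB oUb); first exact: sc.
by apply: (smoothZ oUb); apply: sK.
Qed.

(** The quarters arise where a half curvature term of the outer derivative meets one of the inner
    derivative. Nothing is symmetrized: the Laplacian takes the trace of this formula, the curvature
    of TM its commutator. *)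
Lemma covh_covh a a' A B z : smooth_on Ub A -> smooth_on Ub B -> Ub z ->
  let x := b z in let P := b a in let P' := b a' in
  let u := F (s z) z in let Q := c a s z in let Q' := c a' s z in
  covh G Phi b s a (covh G Phi b s a' A B) (covv G b s a' A B) z =
  c a (c a' A) z
  + 2^-1 *: (dcurv G x P u Q' (A z) + K x (F Q z) Q' (A z)
             + K x u (c a (c a' s) z) (A z) + K x u Q' (c a A z))
  + 2^-1 *: (dcurv G x P u (B z) P' + K x (F Q z) (B z) P'
             + K x u (c a B z) P' + K x u (B z) (Gam G x P P'))
  + 2^-1 *: K x u Q (c a' A z) + 4^-1 *: K x u Q (K x u Q' (A z))
  + 4^-1 *: K x u Q (K x u (B z) P')
  + 2^-1 *: K x u (c a' B z) P - 4^-1 *: K x u (K x P' (A z) (s z)) P.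
Proof.
move=> sA sB Uz x P P' u Q Q'; have Ux : U x by [].
have s1 := sc a' sA; have sq := sc a' ss; have su := sF ss.
have s2 := sK su sq sA; have s3 := sK su sB (scst P').
have sh2 := smoothZ oUb 2^-1 s2; have sh3 := smoothZ oUb 2^-1 s3.
have E0 : c a (covh G Phi b s a' A B) z = c a (c a' A) z
  + 2^-1 *: (dcurv G x P u Q' (A z) + K x (F Q z) Q' (A z)
             + K x u (c a (c a' s) z) (A z) + K x u Q' (c a A z))
  + 2^-1 *: (dcurv G x P u (B z) P' + K x (F Q z) (B z) P'
             + K x u (c a B z) P' + K x u (B z) (Gam G x P P')).
  have E1 := covD G a (smoothD oUb s1 sh2) sh3 Uz.
  apply: etrans E1 _.
  have E5 := cov_curv oU sG uG lb cb a su sq sA Uz.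
  have E6 := cov_curv oU sG uG lb cb a su sB (scst P') Uz.
  have E7 := cov_endo oU sPhi parallel lb cb a ss Uz.
  rewrite E7 in E5 E6; rewrite cov_base in E6.
  by rewrite (covD G a s1 sh2 Uz) (covZ G a 2^-1 s2 Uz)
    (covZ G a 2^-1 s3 Uz) E5 E6.
rewrite {1}/covh E0 {E0} /covh /covv -/x -/P -/P' -/u -/Q -/Q'.
have l2 v w := curv_linear2 oU sG uG v w Ux; have l3 v w := curv_linear3 oU sG uG v w Ux.
rewrite (linear_half_add _ _ _ (l3 u Q)) (linear_half_sub _ _ (l2 u P)); vector_lra.
Qed.

Lemma covv_covv a a' A B z : smooth_on Ub A -> smooth_on Ub B -> Ub z ->
  let x := b z in let P := b a in let P' := b a' in
  let u := F (s z) z in let Q := c a s z in let Q' := c a' s z in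
  covv G b s a (covh G Phi b s a' A B) (covv G b s a' A B) z =
  c a (c a' B) z
  - 2^-1 *: (dcurv G x P P' (A z) (s z) + K x (Gam G x P P') (A z) (s z)
             + K x P' (c a A z) (s z) + K x P' (A z) Q)
  - 2^-1 *: K x P (c a' A z) (s z) - 4^-1 *: K x P (K x u Q' (A z)) (s z)
  - 4^-1 *: K x P (K x u (B z) P') (s z).
Proof.
move=> sA sB Uz x P P' u Q Q'; have Ux : U x by [].
have s1 := sc a' sB; have s2 := sK (scst P') sA ss; have sh2 := smoothZ oUb 2^-1 s2.
have E0 : c a (covv G b s a' A B) z = c a (c a' B) z
  - 2^-1 *: (dcurv G x P P' (A z) (s z) + K x (Gam G x P P') (A z) (s z)
             + K x P' (c a A z) (s z) + K x P' (A z) Q).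
  have E1 := covB G oU cb a s1 sh2 Uz.
  apply: etrans E1 _.
  have E6 := cov_curv oU sG uG lb cb a (scst P') sA ss Uz.
  rewrite cov_base in E6.
  by rewrite (covZ G a 2^-1 s2 Uz) E6.
rewrite {1}/covv E0 {E0} /covh -/x -/P -/P' -/u -/Q -/Q'.
have l2 v w := curv_linear2 oU sG uG v w Ux.
rewrite (linear_half_add _ _ _ (l2 P (s z))); vector_lra.
Qed.

End Second.

(** * Curvature of the phi-Sasaki metric *)

Section SasakiCurvature.
Context {R : realType}.
Variables (n : nat) (U : set 'rV[R]_n) (G Phi : 'rV[R]_n -> 'M[R]_n).
Hypothesis oU : open U.
Hypothesis sG : smooth_on U G.
Hypothesis uG : forall x, U x -> G x \in unitmx.
Hypothesis symG : forall x, U x -> (G x)^T = G x.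
Hypothesis posG : forall x, U x -> forall v, v != 0 -> 0 < form (G x) v v.
Hypothesis sPhi : smooth_on U Phi.
Hypothesis pure : forall x, U x -> forall v w,
  form (G x) (v *m Phi x) w = form (G x) v (w *m Phi x).
Hypothesis parallel : forall x, U x -> forall u w,
  'D_u (fun y => w *m Phi y) x + Gam G x u (w *m Phi x) = Gam G x u w *m Phi x.
Hypothesis invol : forall x, U x -> Phi x *m Phi x = 1%:M.

Local Notation K := (curv_at G).
Local Notation H := (sasaki G Phi).
Local Notation pr := (lsubmx : 'rV[R]_(n + n) -> 'rV[R]_n).
Local Notation UT := (pr @^-1` U).
Local Notation cn := (connector G).

(** Along the identity of TM the pullback connection is the connection of TM, and for constant
    directions its commutator is the curvature. Terms with a single derivative of [A] or [B], and
    those with [Gam G x P P'], are symmetric in [a] and [a'] and drop out; the second derivatives of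
    [A], [B] and the fibre coordinate leave curvatures by [cov_comm]. *)
Lemma curv_sasaki (y a a' e : 'rV[R]_(n + n)) : UT y ->
  let x := pr y in let u := rsubmx y *m Phi x in
  let P := pr a in let P' := pr a' in let Q := cn y a in let Q' := cn y a' in
  let A := pr e in let B := cn y e in
  curv_at H y a a' e = hv G y
  (K x P P' A + 2^-1 *: (dcurv G x P u Q' A - dcurv G x P' u Q A)
   + 2^-1 *: (K x (Q *m Phi x) Q' A - K x (Q' *m Phi x) Q A)
   + 2^-1 *: K x u (K x P P' (rsubmx y)) A
   + 2^-1 *: (dcurv G x P u B P' - dcurv G x P' u B P)
   + 2^-1 *: (K x (Q *m Phi x) B P' - K x (Q' *m Phi x) B P)
   + 4^-1 *: (K x u Q (K x u Q' A) - K x u Q' (K x u Q A))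
   + 4^-1 *: (K x u Q (K x u B P') - K x u Q' (K x u B P))
   - 4^-1 *: (K x u (K x P' A (rsubmx y)) P - K x u (K x P A (rsubmx y)) P'))
  (K x P P' B
   - 2^-1 *: (dcurv G x P P' A (rsubmx y) - dcurv G x P' P A (rsubmx y))
   - 2^-1 *: (K x P' A Q - K x P A Q')
   - 4^-1 *: (K x P (K x u Q' A) (rsubmx y) - K x P' (K x u Q A) (rsubmx y)
              + K x P (K x u B P') (rsubmx y) - K x P' (K x u B P) (rsubmx y))).
Proof.
move=> Uy x u P P' Q Q' A B; have Ux : U x by [].
have lpr := @lsubmx_linear R n.
have cpr : continuous pr by exact: continuous_lsubmx.
have oUT : open UT by exact: open_preimage oU cpr.
have sr := smooth_rsubmx oUT.
have sA : smooth_on UT (fun=> A) by exact: smooth_cst.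
have sB : smooth_on UT (fun y => cn y e) by exact: (smooth_connector oU sG uG e).
have fE z : UT z -> z = row_mx (pr z) (rsubmx z) by rewrite hsubmxK.
have pull c W z : UT z -> pullback_nabla H (fun z => z) (fun=> c) W z =
    'D_c W z + Gam H z c (W z).
  by move=> Uz; rewrite /pullback_nabla /dmap derive_id.
have pb := pullback_hv oU sG uG symG posG sPhi pure parallel invol lpr cpr sr fE.
pose h c := covh G Phi pr rsubmx c (fun=> A) (fun y => cn y e).
pose v c := covv G pr rsubmx c (fun=> A) (fun y => cn y e).
have GE c z : UT z -> Gam H z c e = hv G z (h c z) (v c z).
  move=> Uz; rewrite -(pb (fun=> c) (fun=> e)) //; last by move=> z' _; exact: hvE.
  by rewrite pull // derive_cst add0r.
have sh c : smooth_on UT (h c) by exact: smooth_covh.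
have sv c : smooth_on UT (v c) by exact: smooth_covv.
have N c c' : 'D_c (fun z => Gam H z c' e) y + Gam H y c (Gam H y c' e) =
   hv G y (covh G Phi pr rsubmx c (h c') (v c') y) (covv G pr rsubmx c (h c') (v c') y).
  have E : forall z, UT z -> Gam H z c' e = hv G z (h c' z) (v c' z) by move=> z; exact: GE.
  by rewrite -(pb (fun=> c) _ _ _ _ E) // pull.
rewrite curv_atE !N hvB.
have H2 c c' := covh_covh oU sG uG sPhi parallel lpr cpr sr c c' sA sB Uy.
have V2 c c' := covv_covv Phi oU sG uG lpr cpr sr c c' sA sB Uy.
lazy zeta beta in H2; lazy zeta beta in V2.
rewrite (H2 a a') (H2 a' a) (V2 a a') (V2 a' a) {H2 V2}.
rewrite -!connectorE -/x -/u -/P -/P' -/Q -/Q' -/B.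
have CA := cov_comm oU sG uG lpr cpr a a' sA Uy.
have CB := cov_comm oU sG uG lpr cpr a a' sB Uy.
have Cs := cov_comm oU sG uG lpr cpr a a' sr Uy.
lazy beta in CA; lazy beta in CB; lazy beta in Cs.
rewrite (GamC oU sG uG symG P' P Ux).
have l2 v1 w1 := curv_linear2 oU sG uG v1 w1 Ux.
move: CA CB Cs; rewrite -/x -/P -/P' -/B => <- <- <-.
rewrite (linear_sub _ _ (l2 u A)).
congr (hv G y _ _); vector_lra.
Qed.

End SasakiCurvature.

(** * Tension and bitension fields of a section *)

Section Fields.
Context {R : realType}.
Variables (n : nat) (U : set 'rV[R]_n) (G : 'rV[R]_n -> 'M[R]_n).
Hypothesis oU : open U.
Hypothesis sG : smooth_on U G.
Hypothesis uG : forall x, U x -> G x \in unitmx.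
Hypothesis symG : forall x, U x -> (G x)^T = G x.

Local Notation K := (curv_at G).
Local Notation nab := (cov G (fun x => x)).

Let lid := @linear_idr R n.
Let cid := @continuous_idr R n.

Lemma nablaE A B x : nabla G A B x = nab (A x) B x.
Proof. by []. Qed.

Let covlin C : smooth_on U C -> forall x, U x -> linear (fun v => nab v C x).
Proof. by move=> sC x Ux; exact: (cov_linear_dir G lid sC Ux). Qed.

Let scov v C : smooth_on U C -> smooth_on U (nab v C).
Proof. exact: (smooth_cov oU sG uG lid cid). Qed.

Lemma smooth_nabla A B : smooth_on U A -> smooth_on U B -> smooth_on U (nabla G A B).
Proof.
move=> sA sB.
exact: (smooth_apply oU (T := fun x v => nab v B x) (covlin sB) (fun v => scov v sB) sA).
Qed.

Lemma nabla_nabla A B C x : smooth_on U A -> smooth_on U B -> smooth_on U C -> U x ->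
  nabla G A (nabla G B C) x = nab (A x) (nab (B x) C) x + nab ('D_(A x) B x) C x.
Proof.
move=> sA sB sC Ux; rewrite /nabla -/(nabla G B C).
have D := derive_apply oU (T := fun x v => nab v C x) (covlin sC) (fun v => scov v sC) sB (A x) Ux.
by apply: etrans (congr1 (fun d => d + _) D) _; rewrite addrAC.
Qed.

(** Tensoriality: derivatives of [A] and [B] enter the commutator only as a covariant derivative of
    [C] along their bracket, which the last term of [curv] removes. *)
Lemma curv_field A B C x : smooth_on U A -> smooth_on U B -> smooth_on U C -> U x ->
  curv G A B C x = K x (A x) (B x) (C x).
Proof.
move=> sA sB sC Ux.
have -> : curv G A B C x = nabla G A (nabla G B C) x - nabla G B (nabla G A C) x
  - nabla G (lie_bracket A B) C x by [].
rewrite (nabla_nabla sA sB sC Ux) (nabla_nabla sB sA sC Ux) nablaE (linear_sub _ _ (covlin sC Ux)).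
have E := cov_comm oU sG uG lid cid (A x) (B x) sC Ux; lazy beta in E; rewrite -E.
vector_lra.
Qed.

Lemma smooth_curv_field A B C : smooth_on U A -> smooth_on U B -> smooth_on U C ->
  smooth_on U (fun x => K x (A x) (B x) (C x)).
Proof. exact: (smooth_curvA oU sG uG lid cid). Qed.

Lemma nabla_curv_field W A B C x :
  smooth_on U W -> smooth_on U A -> smooth_on U B -> smooth_on U C -> U x ->
  nabla_curv G W A B C x = dcurv G x (W x) (A x) (B x) (C x).
Proof.
move=> sW sA sB sC Ux.
have -> : nabla_curv G W A B C x = nab (W x) (curv G A B C) x - curv G (nabla G W A) B C x
  - curv G A (nabla G W B) C x - curv G A B (nabla G W C) x by [].
have sn Y : smooth_on U Y -> smooth_on U (nabla G W Y) by exact: smooth_nabla.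
have E0 : nab (W x) (curv G A B C) x = nab (W x) (fun y => K y (A y) (B y) (C y)) x.
  by apply: (cov_eq G oU cid (W x) _ Ux) => y Uy; exact: curv_field.
have E1 := cov_curv oU sG uG lid cid (W x) sA sB sC Ux; lazy beta in E1.
rewrite (etrans E0 E1) {E0 E1}.
have C1 := curv_field (sn A sA) sB sC Ux; have C2 := curv_field sA (sn B sB) sC Ux.
have C3 := curv_field sA sB (sn C sC) Ux; rewrite C1 C2 C3 !nablaE; vector_lra.
Qed.

Lemma dcurv_antisym x p u v w : U x -> dcurv G x p u v w = - dcurv G x p v u w.
Proof.
move=> Ux.
have d : derivable (fun y => K y v u w) x p.
  have sK := smooth_curv oU sG uG v u w.
  by apply: smooth_derivable sK Ux.
have E : 'D_p (fun y => K y u v w) x = - 'D_p (fun y => K y v u w) x.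
  have F : (fun y => K y u v w) = - (fun y => K y v u w).
    by apply/funext => y; rewrite (curv_antisym G y u v w).
  exact: etrans (congr1 (fun f => 'D_p f x) F) (deriveN d).
have key d1 d2 : d1 = - d2 ->
    d1 + Gam G x p (K x u v w) - K x (Gam G x p u) v w - K x u (Gam G x p v) w
      - K x u v (Gam G x p w) =
    - (d2 + Gam G x p (K x v u w) - K x (Gam G x p v) u w - K x v (Gam G x p u) w
      - K x v u (Gam G x p w)).
  move=> ->; rewrite (curv_antisym G x u v w) (curv_antisym G x (Gam G x p u) v w).
  rewrite (curv_antisym G x u (Gam G x p v) w) (curv_antisym G x u v (Gam G x p w)).
  rewrite (linear_opp _ (Gam_linearl G x p)); vector_lra.
exact: key E.
Qed.

(** [trg] at one point, with the integrand already evaluated on the coordinate frame; in this form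
    the integrand is accessible to pointwise algebra. *)
Definition mtr (x : 'rV[R]_n) p (F : 'I_n -> 'I_n -> 'rV[R]_p) : 'rV[R]_p :=
  \sum_(i < n) \sum_(j < n) invmx (G x) i j *: F i j.

Lemma mtrD x p (F F' : 'I_n -> 'I_n -> 'rV[R]_p) :
  mtr x (fun i j => F i j + F' i j) = mtr x F + mtr x F'.
Proof.
rewrite /mtr -big_split; apply: eq_bigr => i _; rewrite -big_split.
by apply: eq_bigr => j _; rewrite scalerDr.
Qed.

Lemma mtr_linear x p q (L : 'rV[R]_p -> 'rV[R]_q) (F : 'I_n -> 'I_n -> 'rV[R]_p) :
  linear L -> L (mtr x F) = mtr x (fun i j => L (F i j)).
Proof.
move=> lL; pose L' : {linear 'rV[R]_p -> 'rV[R]_q} :=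
  HB.pack L (GRing.isLinear.Build _ _ _ _ _ lL).
rewrite /mtr -[L _]/(L' _) linear_sum; apply: eq_bigr => i _.
by rewrite linear_sum; apply: eq_bigr => j _; rewrite linearZ.
Qed.

Lemma mtrN x p (F : 'I_n -> 'I_n -> 'rV[R]_p) : mtr x (fun i j => - F i j) = - mtr x F.
Proof.
apply/esym; apply: (mtr_linear x (L := fun v => - v) F) => a u v.
by rewrite opprD scalerN.
Qed.

Lemma mtrZ x p a (F : 'I_n -> 'I_n -> 'rV[R]_p) : mtr x (fun i j => a *: F i j) = a *: mtr x F.
Proof.
apply/esym; apply: (mtr_linear x (L := fun v => a *: v) F) => r u v.
by rewrite scalerDr !scalerA mulrC.
Qed.

Lemma eq_mtr x p (F F' : 'I_n -> 'I_n -> 'rV[R]_p) :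
  (forall i j, F i j = F' i j) -> mtr x F = mtr x F'.
Proof. by move=> E; apply: eq_bigr => i _; apply: eq_bigr => j _; rewrite E. Qed.

(** The inverse metric is symmetric, so the trace sees only the symmetric part of its integrand. *)
Lemma mtr_skew x p (F : 'I_n -> 'I_n -> 'rV[R]_p) : U x ->
  (forall i j, F i j + F j i = 0) -> mtr x F = 0.
Proof.
move=> Ux Fa; have E : mtr x F = - mtr x F.
  rewrite -mtrN /mtr exchange_big; apply: eq_bigr => i _; apply: eq_bigr => j _.
  have -> : invmx (G x) j i = invmx (G x) i j.
    by rewrite -[in LHS](symG Ux) -trmx_inv mxE.
  by congr (_ *: _); apply/eqP; rewrite -addr_eq0 Fa.
apply/rowP => k; move/rowP/(_ k): E; rewrite !mxE.
by move: (mtr x F 0 k) => r ?; lra.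
Qed.

Lemma smooth_mtr p (F : 'I_n -> 'I_n -> 'rV[R]_n -> 'rV[R]_p) :
  (forall i j, smooth_on U (F i j)) -> smooth_on U (fun x => mtr x (fun i j => F i j x)).
Proof.
move=> sF; apply: smooth_sum => // i; apply: smooth_sum => // j.
apply: smooth_scale => //; apply: smooth_entry => //; exact: smooth_invmx.
Qed.

Lemma mtr_hv x y (p q : 'I_n -> 'I_n -> 'rV[R]_n) :
  mtr x (fun i j => hv G y (p i j) (q i j)) = hv G y (mtr x p) (mtr x q).
Proof.
rewrite /mtr -hv_sum; apply: eq_bigr => i _; rewrite -hv_sum.
by apply: eq_bigr => j _; rewrite hvZ.
Qed.

(** The tensorial second covariant derivative in the coordinate frame, whose own covariant
    derivatives are the vectors [Gam]. *)
Definition cov2 (Y : 'rV[R]_n -> 'rV[R]_n) x (i j : 'I_n) : 'rV[R]_n :=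
  nab (delta_mx 0 i) (nab (delta_mx 0 j) Y) x
  - nab (Gam G x (delta_mx 0 i) (delta_mx 0 j)) Y x.

Lemma rough_lapE Y x : rough_lap G Y x = - mtr x (cov2 Y x).
Proof.
congr (- _); apply: eq_mtr => i j; congr (_ - _).
by rewrite nablaE /nabla derive_cst add0r.
Qed.

Lemma smooth_rough_lap Y : smooth_on U Y -> smooth_on U (rough_lap G Y).
Proof.
move=> sY; apply: (smooth_eq oU (f := fun x => - mtr x (fun i j => cov2 Y x i j))).
  by move=> x _; rewrite rough_lapE.
apply: (smoothN oU); apply: (smooth_mtr (F := fun i j x => cov2 Y x i j)) => i j.
apply: (smoothB oU); first by apply: scov; exact: scov.
exact: (smooth_apply oU (T := fun x v => nab v Y x) (covlin sY) (fun v => scov v sY)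
  (smooth_Gam oU sG uG (delta_mx 0 i) (delta_mx 0 j))).
Qed.

End Fields.

(* Pointwise algebra of the bitension field.  [K] and [dK] are the curvature and
   its covariant derivative, [u] is phi xi, [p] is S(xi), [l] is the rough
   Laplacian of xi and [lF] is phi l; [e] is the coordinate frame, [Q], [Sp] and
   [Lp] are the covariant derivatives of xi, S(xi) and Lap xi along it, [QF] is
   phi Q, and [DX], [DS], [DL] are the second covariant derivatives.  [lap_*] is
   the integrand of minus the rough Laplacian of the tension field, [jac_*] that
   of the curvature term, [rhs_*] the integrand of the trace in the theorem. *)
Section Cancellation.
Context {R : realType}.
Variables (n : nat) (K : 'rV[R]_n -> 'rV[R]_n -> 'rV[R]_n -> 'rV[R]_n).
Variable dK : 'rV[R]_n -> 'rV[R]_n -> 'rV[R]_n -> 'rV[R]_n -> 'rV[R]_n.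
Hypothesis KA : forall a b c, K a b c = - K b a c.
Hypothesis KN2 : forall a b c, K a (- b) c = - K a b c.
Hypothesis KN3 : forall a b c, K a b (- c) = - K a b c.
Hypothesis dKA : forall a b c d, dK a b c d = - dK a c b d.

Let KN1 a b c : K (- a) b c = - K a b c.
Proof. by rewrite KA KN2 -KA. Qed.

Ltac solve_vectors := repeat match goal with
  | |- context [K ?u ?v ?w] => generalize (K u v w); intro
  | |- context [dK ?a ?u ?v ?w] => generalize (dK a u v w); intro
  end; apply/rowP => ?; rewrite !mxE; lra.

Variables (u xi p l lF : 'rV[R]_n) (e Q QF Sp Lp : 'I_n -> 'rV[R]_n).
Variables (DS DX DL : 'I_n -> 'I_n -> 'rV[R]_n).

Definition lap_h i j := DS i j
  + 2^-1 *: (dK (e i) u (Q j) p + K (QF i) (Q j) p + K u (DX i j) p + K u (Q j) (Sp i))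
  + 2^-1 *: (dK (e i) u (- l) (e j) + K (QF i) (- l) (e j) + K u (- Lp i) (e j))
  + 2^-1 *: K u (Q i) (Sp j) + 4^-1 *: K u (Q i) (K u (Q j) p)
  + 4^-1 *: K u (Q i) (K u (- l) (e j))
  + 2^-1 *: K u (- Lp j) (e i) - 4^-1 *: K u (K (e j) p xi) (e i).

Definition lap_v i j := - DL i j
  - 2^-1 *: (dK (e i) (e j) p xi + K (e j) (Sp i) xi + K (e j) p (Q i))
  - 2^-1 *: K (e i) (Sp j) xi - 4^-1 *: K (e i) (K u (Q j) p) xi
  - 4^-1 *: K (e i) (K u (- l) (e j)) xi.

Definition jac_h i j := K p (e i) (e j) + 2^-1 *: (dK p u (Q i) (e j) - dK (e i) u (- l) (e j))
  + 2^-1 *: (K (- lF) (Q i) (e j) - K (QF i) (- l) (e j))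
  + 2^-1 *: K u (K p (e i) xi) (e j)
  + 2^-1 *: (dK p u (Q j) (e i) - dK (e i) u (Q j) p)
  + 2^-1 *: (K (- lF) (Q j) (e i) - K (QF i) (Q j) p)
  + 4^-1 *: (K u (- l) (K u (Q i) (e j)) - K u (Q i) (K u (- l) (e j)))
  + 4^-1 *: (K u (- l) (K u (Q j) (e i)) - K u (Q i) (K u (Q j) p))
  - 4^-1 *: (K u (K (e i) (e j) xi) p - K u (K p (e j) xi) (e i)).

Definition jac_v i j := K p (e i) (Q j) - 2^-1 *: (dK p (e i) (e j) xi - dK (e i) p (e j) xi)
  - 2^-1 *: (K (e i) (e j) (- l) - K p (e j) (Q i))
  - 4^-1 *: (K p (K u (Q i) (e j)) xi - K (e i) (K u (- l) (e j)) xi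
             + K p (K u (Q j) (e i)) xi - K (e i) (K u (Q j) p) xi).

Definition rhs_h i j := K p (e i) (e j) + dK p u (Q i) (e j) + K u (Q i) (Sp j)
  - K u (K (e i) p xi) (e j) - K u (Lp i) (e j) - K lF (Q i) (e j).

Definition rhs_v i j := dK (e i) (e j) p xi + K (e i) (Sp j) xi + 2 *: K (e i) p (Q j).

(** The last two summands of [F] survive symmetrization. Under the trace [DX] becomes [- l] and
    [K u (Q i) (e j)] becomes [p], so each contributes one half of [K u l p], the term of the
    theorem outside the trace. *)
Lemma horizontal_cancellation i j :
  let F i j := lap_h i j + jac_h i j - DS i j - rhs_h i j - 2^-1 *: K u (DX i j) p
    + 2^-1 *: K u l (K u (Q i) (e j)) in
  F i j + F j i = 0.
Proof.
rewrite /lap_h /jac_h /rhs_h !KN1 !KN2 !KN3.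
rewrite !(KA p) (KA (e j) (e i)) !KN2; solve_vectors.
Qed.

(** Here the surviving summand traces to a multiple of [K p p xi], which is zero by antisymmetry. *)
Lemma vertical_cancellation i j :
  let F i j := lap_v i j + jac_v i j + DL i j + rhs_v i j + 2^-1 *: K p (K u (Q i) (e j)) xi in
  F i j + F j i = 0.
Proof.
rewrite /lap_v /jac_v /rhs_v !KN2 !KN3.
rewrite (KA p (e i)) (KA p (e j)) (KA (e j) (e i)) (dKA (e i) p) (dKA (e j) p) (dKA p (e j) (e i)).
solve_vectors.
Qed.

End Cancellation.

(** * The sesqui-tension field of a section in one chart *)

Section Local.
Context {R : realType}.
Variables (n : nat) (U : set 'rV[R]_n) (G Phi : 'rV[R]_n -> 'M[R]_n).
Hypothesis oU : open U.
Hypothesis sG : smooth_on U G.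
Hypothesis uG : forall x, U x -> G x \in unitmx.
Hypothesis symG : forall x, U x -> (G x)^T = G x.
Hypothesis posG : forall x, U x -> forall v, v != 0 -> 0 < form (G x) v v.
Hypothesis sPhi : smooth_on U Phi.
Hypothesis pure : forall x, U x -> forall v w,
  form (G x) (v *m Phi x) w = form (G x) v (w *m Phi x).
Hypothesis parallel : forall x, U x -> forall u w,
  'D_u (fun y => w *m Phi y) x + Gam G x u (w *m Phi x) = Gam G x u w *m Phi x.
Hypothesis invol : forall x, U x -> Phi x *m Phi x = 1%:M.
Variables (X : 'rV[R]_n -> 'rV[R]_n) (f : 'rV[R]_n -> 'rV[R]_(n + n)).
Hypothesis sX : smooth_on U X.
Hypothesis fE : forall z, U z -> f z = row_mx z (X z).

Local Notation K := (curv_at G).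
Local Notation H := (sasaki G Phi).
Local Notation idr := (fun x : 'rV[R]_n => x).
Local Notation nab := (cov G idr).
Local Notation e i := (delta_mx 0 i : 'rV[R]_n).
Local Notation FX := (apply_endo Phi X).
Local Notation L := (rough_lap G X).
Local Notation S := (Sfield G Phi X).
Local Notation tr x := (mtr G x).

Let lid := @linear_idr R n.
Let cid := @continuous_idr R n.

Let sn v A : smooth_on U A -> smooth_on U (nab v A).
Proof. exact: (smooth_cov oU sG uG lid cid v). Qed.
Let sc (v : 'rV[R]_n) : smooth_on U (fun=> v).
Proof. exact: smooth_cst. Qed.
Let sFX : smooth_on U FX.
Proof. exact: (smooth_endoA oU sPhi lid cid sX). Qed.

Lemma SfieldE x : U x -> S x = tr x (fun i j => K x (X x *m Phi x) (nab (e i) X x) (e j)).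
Proof.
move=> Ux; apply: eq_mtr => i j.
exact: (curv_field oU sG uG sFX (sn (e i) sX) (sc (e j)) Ux).
Qed.

Lemma smooth_Sfield : smooth_on U S.
Proof.
apply: (smooth_eq oU (f := fun x => tr x (fun i j => K x (X x *m Phi x) (nab (e i) X x) (e j)))).
  by move=> x Ux; rewrite SfieldE.
apply: (smooth_mtr oU sG uG (F := fun i j x => K x (X x *m Phi x) (nab (e i) X x) (e j))) => i j.
exact: (smooth_curv_field oU sG uG sFX (sn (e i) sX) (sc (e j))).
Qed.

Let sL : smooth_on U L.
Proof. exact: smooth_rough_lap. Qed.

Let pb := pullback_hv oU sG uG symG posG sPhi pure parallel invol lid cid sX fE.
Let dm := dmap_hv G oU lid cid sX fE.

Lemma dmap_coord j z : U z -> dmap f (coord_field j) z = hv G (f z) (e j) (nab (e j) X z).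
Proof. exact: dm. Qed.

(** Under the trace the two horizontal half terms coincide and add up to [S], while the vertical
    curvature term is skew in the frame indices and disappears. *)
Lemma tensionE x : U x -> tension G H f x = hv G (f x) (S x) (- L x).
Proof.
move=> Ux.
pose p i j := 2^-1 *: K x (X x *m Phi x) (nab (e i) X x) (e j)
  + 2^-1 *: K x (X x *m Phi x) (nab (e j) X x) (e i).
pose q i j := cov2 G X x i j - 2^-1 *: K x (e i) (e j) (X x).
transitivity (tr x (fun i j => hv G (f x) (p i j) (q i j))).
  apply: eq_mtr => i j.
  have E1 : pullback_nabla H f (coord_field i) (dmap f (coord_field j)) x = hv G (f x)
      (covh G Phi idr X (e i) (fun=> e j) (nab (e j) X) x)
      (covv G idr X (e i) (fun=> e j) (nab (e j) X) x).
    exact: (pb (coord_field i) (dmap_coord j) (sc (e j)) (sn (e j) sX) Ux).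
  have E2 := dm (nabla G (coord_field i) (coord_field j)) Ux.
  have E3 : nabla G (coord_field i) (coord_field j) x = Gam G x (e i) (e j).
    by rewrite /nabla derive_cst add0r.
  apply: etrans (congr2 (fun a b => a - b) E1 E2) _.
  have E4 : nab (e i) (fun=> e j) x = Gam G x (e i) (e j).
    by rewrite /cov derive_cst add0r.
  rewrite hvB E3 /covh /covv /p /q /cov2 E4; congr (hv G _ _ _); vector_lra.
rewrite mtr_hv; congr (hv G _ _ _).
  rewrite (SfieldE Ux) -[RHS]add0r; apply/eqP; rewrite -subr_eq; apply/eqP.
  rewrite -mtrN -mtrD; apply: (mtr_skew symG Ux) => i j; rewrite /p; vector_lra.
rewrite rough_lapE opprK -[RHS]add0r; apply/eqP; rewrite -subr_eq; apply/eqP.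
rewrite -mtrN -mtrD; apply: (mtr_skew symG Ux) => i j; rewrite /q.
rewrite (curv_antisym G x (e j) (e i)); move: (cov2 G X x i j) (cov2 G X x j i) => ??; vector_lra.
Qed.

(** The outer sign of the vertical component is that of [- L] in the tension field. *)
Lemma sesqui_lifts (d1 d2 : R) x : U x ->
  let u := X x *m Phi x in let p := S x in let l := L x in
  let Q i := nab (e i) X x in let Sp i := nab (e i) S x in
  let Lp i := nab (e i) L x in
  (d1 *: tension G H f + d2 *: bitension G H f) x = hv G (f x)
    (d1 *: p + d2 *: rough_lap G S x + d2 *: K x u l p
     - d2 *: tr x (rhs_h (K x) (dcurv G x) u (X x) p (l *m Phi x) (fun i => e i) Q Sp Lp))
    (- (d1 *: l + d2 *: rough_lap G L x
     - d2 *: tr x (rhs_v (K x) (dcurv G x) (X x) p (fun i => e i) Q Sp))).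
Proof.
move=> Ux u p l Q Sp Lp; have sS := smooth_Sfield.
pose NL z := - L z; have sNL : smooth_on U NL by exact: smoothN.
have tE z : U z -> tension G H f z = hv G (f z) (S z) (NL z) by exact: tensionE.
have P1 j z : U z -> pullback_nabla H f (coord_field j) (tension G H f) z =
    hv G (f z) (covh G Phi idr X (e j) S NL z) (covv G idr X (e j) S NL z).
  exact: (pb (coord_field j) tE sS sNL).
have sh j : smooth_on U (covh G Phi idr X (e j) S NL).
  exact: (smooth_covh oU sG uG sPhi lid cid sX (e j) sS sNL).
have sv j : smooth_on U (covv G idr X (e j) S NL).
  exact: (smooth_covv oU sG uG lid cid sX (e j) sS sNL).
have E3 i j : nabla G (coord_field i) (coord_field j) x = Gam G x (e i) (e j).
  by rewrite /nabla derive_cst add0r.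
have N1 v : nab v NL x = - nab v L x by exact: (covN G oU cid v sL Ux).
have N2 i j : nab (e i) (nab (e j) NL) x = - nab (e i) (nab (e j) L) x.
  rewrite -(covN G oU cid (e i) (sn (e j) sL) Ux).
  by apply: (cov_eq G oU cid (e i) _ Ux) => y Uy; exact: (covN G oU cid (e j) sL Uy).
have l2 v w := curv_linear2 oU sG uG v w Ux; have l3 v w := curv_linear3 oU sG uG v w Ux.
pose QF i := Q i *m Phi x.
pose Ph := lap_h (K x) (dcurv G x) u (X x) p l (fun i => e i) Q QF Sp Lp (cov2 G S x) (cov2 G X x).
pose Pv := lap_v (K x) (dcurv G x) u (X x) p l (fun i => e i) Q Sp (cov2 G L x).
pose Ch := jac_h (K x) (dcurv G x) u (X x) p l (l *m Phi x) (fun i => e i) Q QF.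
pose Cv := jac_v (K x) (dcurv G x) u (X x) p l (fun i => e i) Q.
have EP i j : pullback_nabla H f (coord_field i) (pullback_nabla H f (coord_field j) (tension G H f)) x
    - pullback_nabla H f (nabla G (coord_field i) (coord_field j)) (tension G H f) x =
    hv G (f x) (Ph i j) (Pv i j).
  have T1 := pb (coord_field i) (P1 j) (sh j) (sv j) Ux.
  have T2 := pb (nabla G (coord_field i) (coord_field j)) tE sS sNL Ux.
  have H2 := covh_covh oU sG uG sPhi parallel lid cid sX (e i) (e j) sS sNL Ux.
  have V2 := covv_covv Phi oU sG uG lid cid sX (e i) (e j) sS sNL Ux.
  lazy zeta beta in H2; lazy zeta beta in V2.
  apply: etrans (congr2 (fun a b => a - b) (etrans T1 (congr2 (hv G (f x)) H2 V2)) T2) _.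
  rewrite hvB E3 /covh /covv N2 !N1 /Ph /Pv /lap_h /lap_v /cov2.
  rewrite (linear_sub _ _ (l2 u p)) -/u -/p.
  by congr (hv G _ _ _); rewrite /QF /Q /Sp /Lp /l /NL; vector_lra.
have Uf : (lsubmx : 'rV[R]_(n + n) -> 'rV[R]_n) (f x) = x by rewrite fE // row_mxKl.
have rf : (rsubmx : 'rV[R]_(n + n) -> 'rV[R]_n) (f x) = X x by rewrite fE // row_mxKr.
have EC i j : curv_at H (f x) (tension G H f x) (dmap f (coord_field i) x)
    (dmap f (coord_field j) x) = hv G (f x) (Ch i j) (Cv i j).
  have UTf : ((lsubmx : 'rV[R]_(n + n) -> 'rV[R]_n) @^-1` U) (f x) by rewrite /= Uf.
  have C := curv_sasaki oU sG uG symG posG sPhi pure parallel invol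
    (hv G (f x) (S x) (NL x)) (hv G (f x) (e i) (Q i)) (hv G (f x) (e j) (Q j)) UTf.
  lazy zeta in C; rewrite !lsubmx_hv !connector_hv Uf rf in C.
  rewrite (tE x Ux) (dmap_coord i Ux) (dmap_coord j Ux) C.
  have -> : NL x *m Phi x = - (l *m Phi x) by rewrite /NL mulNmx.
  rewrite /Ch /Cv /jac_h /jac_v /QF /u /p /l /NL; reflexivity.
have -> : (d1 *: tension G H f + d2 *: bitension G H f) x = d1 *: tension G H f x
  + d2 *: (- tr x (fun i j => hv G (f x) (Ph i j) (Pv i j))
           - tr x (fun i j => hv G (f x) (Ch i j) (Cv i j))).
  congr (_ + _ *: (- _ - _)); apply: eq_mtr => i j; [exact: EP|exact: EC].
have hv_comb y a1 b1 a2 b2 a3 b3 : d1 *: hv G y a1 b1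
    + d2 *: (- hv G y a2 b2 - hv G y a3 b3) =
    hv G y (d1 *: a1 + d2 *: (- a2 - a3)) (d1 *: b1 + d2 *: (- b2 - b3)).
  by rewrite !hvN hvD !hvZ hvD.
rewrite (tE x Ux) (mtr_hv G x (f x) Ph Pv) (mtr_hv G x (f x) Ch Cv) hv_comb {hv_comb}.
have trS : tr x (fun i j => K x u (Q i) (e j)) = p by rewrite /p SfieldE.
have trX : tr x (cov2 G X x) = - l by rewrite /l rough_lapE opprK.
have KA a b c : K x a b c = - K x b a c by exact: curv_antisym.
have KN2 a b c : K x a (- b) c = - K x a b c by exact: linear_opp (l2 a c).
have KN3 a b c : K x a b (- c) = - K x a b c by exact: linear_opp (l3 a b).
have dKA a b c d : dcurv G x a b c d = - dcurv G x a c b d by exact: (dcurv_antisym oU sG uG).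
have HC := horizontal_cancellation (dcurv G x) KA KN2 KN3 u (X x) p l (l *m Phi x)
  (fun i => e i) Q QF Sp Lp (cov2 G S x) (cov2 G X x).
have VC := vertical_cancellation KA KN2 KN3 dKA u (X x) p l
  (fun i => e i) Q Sp (cov2 G L x).
have trH := mtr_skew symG Ux HC; have trV := mtr_skew symG Ux VC.
have split_h (F1 F2 F3 F4 F5 F6 : 'I_n -> 'I_n -> 'rV[R]_n) (a : R) :
    tr x (fun i j => F1 i j + F2 i j - F3 i j - F4 i j - a *: F5 i j + a *: F6 i j) =
    tr x F1 + tr x F2 - tr x F3 - tr x F4 - a *: tr x F5 + a *: tr x F6.
  by rewrite !mtrD !mtrN !mtrZ.
have split_v (F1 F2 F3 F4 F5 : 'I_n -> 'I_n -> 'rV[R]_n) (a : R) :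
    tr x (fun i j => F1 i j + F2 i j + F3 i j + F4 i j + a *: F5 i j) =
    tr x F1 + tr x F2 + tr x F3 + tr x F4 + a *: tr x F5.
  by rewrite !mtrD !mtrZ.
have T1 : tr x (fun i j => K x u (cov2 G X x i j) p) = - K x u l p.
  by rewrite -(mtr_linear G x (cov2 G X x) (l2 u p)) trX KN2.
have T2 : tr x (fun i j => K x u l (K x u (Q i) (e j))) = K x u l p.
  by rewrite -(mtr_linear G x _ (l3 u l)) trS.
have T3 : tr x (fun i j => K x p (K x u (Q i) (e j)) (X x)) = 0.
  rewrite -(mtr_linear G x _ (l2 p (X x))) trS.
  have := KA p p (X x); move: (K x p p (X x)) => v /rowP Ev.
  by apply/rowP => i; move: (Ev i); rewrite !mxE; lra.
move: (etrans (esym (split_h _ _ _ _ _ _ _)) trH) (etrans (esym (split_v _ _ _ _ _ _)) trV).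
rewrite T1 T2 T3 -/Ph -/Pv -/Ch -/Cv !rough_lapE /NL -/l -/p.
move: (tr x Ph) (tr x Pv) (tr x Ch) (tr x Cv) (tr x (cov2 G S x)) (tr x (cov2 G L x)).
move: (tr x (rhs_h _ _ _ _ _ _ _ _ _ _)) (tr x (rhs_v _ _ _ _ _ _ _)) (K x u l p).
move=> q1 q2 k ph pv ch cv s2 l2' {}trH {}trV; congr (hv G _ _ _).
  have -> : - ph - ch = - s2 + k - q1.
    by apply/rowP => i; move/rowP/(_ i): trH; rewrite !mxE; lra.
  by apply/rowP => i; rewrite !mxE; ring.
have -> : - pv - cv = l2' + q2.
  by apply/rowP => i; move/rowP/(_ i): trV; rewrite !mxE; lra.
by apply/rowP => i; rewrite !mxE; ring.
Qed.

End Local.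

(** * The stated equations at a point *)

Section Equations.
Context {R : realType}.
Variables (n : nat) (U : set 'rV[R]_n) (G Phi : 'rV[R]_n -> 'M[R]_n).
Hypothesis oU : open U.
Hypothesis sG : smooth_on U G.
Hypothesis uG : forall x, U x -> G x \in unitmx.
Hypothesis sPhi : smooth_on U Phi.
Variable X : 'rV[R]_n -> 'rV[R]_n.
Hypothesis sX : smooth_on U X.

Local Notation K := (curv_at G).
Local Notation nab := (cov G (fun x : 'rV[R]_n => x)).
Local Notation e i := (delta_mx 0 i : 'rV[R]_n).
Local Notation F := (apply_endo Phi).
Local Notation D := (nabla G).
Local Notation Rm := (curv G).
Local Notation DRm := (nabla_curv G).
Local Notation L := (rough_lap G X).
Local Notation S := (Sfield G Phi X).
Local Notation tr x := (mtr G x).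

Let lid := @linear_idr R n.
Let cid := @continuous_idr R n.
Let sn v A : smooth_on U A -> smooth_on U (nab v A).
Proof. exact: (smooth_cov oU sG uG lid cid v). Qed.
Let sc (v : 'rV[R]_n) : smooth_on U (fun=> v).
Proof. exact: smooth_cst. Qed.
Let sF A : smooth_on U A -> smooth_on U (F A).
Proof. by move=> sA; exact: (smooth_endoA oU sPhi lid cid sA). Qed.
Let sS : smooth_on U S.
Proof. exact: (smooth_Sfield oU sG uG sPhi sX). Qed.
Let sL : smooth_on U L.
Proof. exact: smooth_rough_lap. Qed.
Let cf A B C x (sA : smooth_on U A) (sB : smooth_on U B) (sC : smooth_on U C) (Ux : U x) :=
  curv_field oU sG uG sA sB sC Ux.
Let ncf W A B C x (sW : smooth_on U W) (sA : smooth_on U A) (sB : smooth_on U B)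
  (sC : smooth_on U C) (Ux : U x) := nabla_curv_field oU sG uG sW sA sB sC Ux.

Lemma horizontal_trace x : U x ->
  trg G (fun U V =>
    Rm S U V + DRm S (F X) (D U X) V + Rm (F X) (D U X) (D V S)
    - Rm (F X) (Rm U S X) V - Rm (F X) (D U L) V - Rm (F L) (D U X) V) x =
  tr x (rhs_h (K x) (dcurv G x) (X x *m Phi x) (X x) (S x) (L x *m Phi x)
    (fun i => e i) (fun i => nab (e i) X x) (fun i => nab (e i) S x)
    (fun i => nab (e i) L x)).
Proof.
move=> Ux; apply: eq_mtr => i j.
have sQ := sn (e i) sX; have sej := sc (e j); have sei := sc (e i).
have sFX := sF sX.
(* The nested curvature uses tensoriality twice; the outer use requires the inner field to be
   smooth. *)
have sR : smooth_on U (Rm (coord_field i) S X).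
  apply: (smooth_eq oU (f := fun y => K y (e i) (S y) (X y))).
    by move=> y Uy; rewrite -(cf sei sS sX Uy).
  exact: (smooth_curv_field oU sG uG sei sS sX).
have C1 := cf sS sei sej Ux.
have C2 := ncf sS sFX sQ sej Ux.
have C3 := cf sFX sQ (sn (e j) sS) Ux.
have C4 := etrans (cf sFX sR sej Ux)
  (congr1 (fun v => K x (F X x) v (e j)) (cf sei sS sX Ux)).
have C5 := cf sFX (sn (e i) sL) sej Ux.
have C6 := cf (sF sL) sQ sej Ux.
(* Pointwise operations on functions evaluate by conversion, so the six equalities of values
   assemble directly. *)
exact: (congr2 (fun a b => a - b) (congr2 (fun a b => a - b) (congr2 (fun a b => a - b)
  (congr2 (fun a b => a + b) (congr2 (fun a b => a + b) C1 C2) C3) C4) C5) C6).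
Qed.

Lemma vertical_trace x : U x ->
  trg G (fun U V => DRm U V S X + Rm U (D V S) X + 2 *: Rm U S (D V X)) x =
  tr x (rhs_v (K x) (dcurv G x) (X x) (S x) (fun i => e i)
    (fun i => nab (e i) X x) (fun i => nab (e i) S x)).
Proof.
move=> Ux; apply: eq_mtr => i j.
have sej := sc (e j); have sei := sc (e i).
have C1 := ncf sei sej sS sX Ux.
have C2 := cf sei (sn (e j) sS) sX Ux.
have C3 := cf sei sS (sn (e j) sX) Ux.
exact: (congr2 (fun a b => a + b) (congr2 (fun a b => a + b) C1 C2)
  (congr1 (fun a => 2 *: a) C3)).
Qed.

Lemma horizontal_equation (d1 d2 : R) x : U x ->
  (d1 *: S + d2 *: rough_lap G S + d2 *: Rm (F X) L S
   - d2 *: trg G (fun U V =>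
       Rm S U V + DRm S (F X) (D U X) V + Rm (F X) (D U X) (D V S)
       - Rm (F X) (Rm U S X) V - Rm (F X) (D U L) V - Rm (F L) (D U X) V)) x =
  d1 *: S x + d2 *: rough_lap G S x + d2 *: K x (X x *m Phi x) (L x) (S x)
  - d2 *: tr x (rhs_h (K x) (dcurv G x) (X x *m Phi x) (X x) (S x) (L x *m Phi x)
    (fun i => e i) (fun i => nab (e i) X x) (fun i => nab (e i) S x)
    (fun i => nab (e i) L x)).
Proof.
move=> Ux; have E := cf (sF sX) sL sS Ux; have T := horizontal_trace Ux.
exact: (congr2 (fun a b => d1 *: S x + d2 *: rough_lap G S x + d2 *: a - d2 *: b) E T).
Qed.

Lemma vertical_equation (d1 d2 : R) x : U x ->
  (d1 *: L + d2 *: rough_lap G L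
   - d2 *: trg G (fun U V => DRm U V S X + Rm U (D V S) X + 2 *: Rm U S (D V X))) x =
  d1 *: L x + d2 *: rough_lap G L x
  - d2 *: tr x (rhs_v (K x) (dcurv G x) (X x) (S x) (fun i => e i)
    (fun i => nab (e i) X x) (fun i => nab (e i) S x)).
Proof.
move=> Ux.
exact: (congr1 (fun b => d1 *: L x + d2 *: rough_lap G L x - d2 *: b) (vertical_trace Ux)).
Qed.

End Equations.

(** * From charts to the manifold *)

Section Charts.
Context {R : realType}.
Variables (m : nat) (M : atlas R (2 * m)) (phi g : tensor2 M) (xi : vector_field M).
Hypothesis hM : para_kahler_norden phi g.
Hypothesis hxi : is_vector_field xi.
Variable c : chart M.
Local Notation U := (image_chart c).

Lemma open_image_chart : open U.
Proof. by have := @manifold_open _ _ _ (pkn_manifold hM) c c; rewrite setIid. Qed.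

Lemma metric_sym x : U x -> (g c x)^T = g c x.
Proof. by move=> Ux; have [_ /(_ c x Ux) []] := pkn_riemannian hM. Qed.

Lemma metric_pos x : U x -> forall v, v != 0 -> 0 < form (g c x) v v.
Proof. by move=> Ux; have [_ /(_ c x Ux) []] := pkn_riemannian hM. Qed.

Lemma metric_unit x : U x -> g c x \in unitmx.
Proof.
move=> Ux; rewrite -row_free_unit; apply: inj_row_free => v v0.
apply/eqP; apply: contraT => /(metric_pos Ux).
by rewrite /form v0 mul0mx mxE ltxx.
Qed.

Lemma endo_parallel x : U x -> forall u w,
  'D_u (fun y => w *m phi c y) x + Gam (g c) x u (w *m phi c x) =
  Gam (g c) x u w *m phi c x.
Proof.
move=> Ux u w.
have := pkn_parallel hM (smooth_cst U u) (smooth_cst U w) Ux.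
have -> : nabla_endo (g c) (phi c) (fun=> u) (fun=> w) x =
  'D_u (fun y => w *m phi c y) x + Gam (g c) x u (w *m phi c x)
  - ('D_u (fun=> w) x + Gam (g c) x u w) *m phi c x by [].
by rewrite derive_cst add0r => /subr0_eq.
Qed.

(** [section_of] stores the components of xi in the preferred chart of each point, which varies over
    the domain of [c]; the transformation law of a vector field turns them into components in
    [c]. *)
Lemma section_in_charts z : U z ->
  map_in_charts (section_of xi) c (c : chart (tangent_bundle M)) z =
  row_mx z (xi c z).
Proof.
move=> [q cq <-]; have mM := pkn_manifold hM.
rewrite /map_in_charts (manifold_crdK mM cq).
have [_ E] := hxi; have := E _ _ _ (manifold_chart_at mM q) cq.
by move=> Eq; exact: (congr1 (row_mx (crd c q)) Eq).
Qed.

End Charts.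

Theorem theorem5p2 (R : realType) (m : nat) (M : atlas R (2 * m))
    (phi g : tensor2 M) (xi : vector_field M) (delta1 delta2 : R)
    (hM : para_kahler_norden phi g) (hxi : is_vector_field xi) :
  sesqui_harmonic g (phi_sasaki phi g) delta1 delta2 (section_of xi) <->
  (forall p : M,
     let c := chart_at p in
     let D := nabla (g c) in
     let Rm := curv (g c) in
     let DRm := nabla_curv (g c) in
     let Lap := rough_lap (g c) in
     let F := apply_endo (phi c) in
     let X := xi c in
     let S := Sfield (g c) (phi c) X in
     (delta1 *: S + delta2 *: Lap S + delta2 *: Rm (F X) (Lap X) S
      - delta2 *: trg (g c) (fun U V =>
          Rm S U V + DRm S (F X) (D U X) V + Rm (F X) (D U X) (D V S)
          - Rm (F X) (Rm U S X) V - Rm (F X) (D U (Lap X)) V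
          - Rm (F (Lap X)) (D U X) V)) (crd c p) = 0
     /\
     (delta1 *: Lap X + delta2 *: Lap (Lap X)
      - delta2 *: trg (g c) (fun U V =>
          DRm U V S X + Rm U (D V S) X + 2 *: Rm U S (D V X))) (crd c p) = 0).
Proof.
have iff_forall (T : Type) (A B : T -> Prop) :
    (forall t, A t <-> B t) -> (forall t, A t) <-> (forall t, B t).
  by move=> AB; split=> H t; apply/AB.
rewrite /sesqui_harmonic; apply: iff_forall => p; set c := chart_at p.
have cp : dom c p by exact: manifold_chart_at (pkn_manifold hM) p.
have Ux : image_chart c (crd c p) by exists p.
have oU : open (image_chart c) by exact: (open_image_chart hM).
have [[sG _] _] := pkn_riemannian hM; have [sPhi _] := pkn_endo hM.
have [sX _] := hxi.
have uG := @metric_unit _ _ _ _ _ hM c; have symG := @metric_sym _ _ _ _ _ hM c.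
cbv zeta.
rewrite (horizontal_equation oU (sG c) uG (sPhi c) (sX c) delta1 delta2 Ux).
rewrite (vertical_equation oU (sG c) uG (sPhi c) (sX c) delta1 delta2 Ux).
have E := sesqui_lifts oU (sG c) uG symG (@metric_pos _ _ _ _ _ hM c) (sPhi c)
  (@pkn_pure _ _ _ _ _ hM c) (@endo_parallel _ _ _ _ _ hM c) (@pkn_involution _ _ _ _ _ hM c)
  (sX c) (@section_in_charts _ _ _ _ _ _ hM hxi c) delta1 delta2 Ux.
lazy zeta in E.
(* The preferred chart of TM at the image of [p] is the one induced by [c], so the left-hand side of
   [E] is convertible to [sesqui_tension] at [p]. *)
have -> : sesqui_tension g (phi_sasaki phi g) delta1 delta2 (section_of xi) p = _ := E.
rewrite hv_eq0; split=> [[-> /eqP]|[-> ->]]; first by rewrite oppr_eq0 => /eqP.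
by rewrite oppr0.
Qed.
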